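(* Let $d\ge2$. There is a line $l\subset\mathbb R^d$ (passing through the origin) and two positive constants $c$ and $k$ (depending only on $d$) such that for any $\alpha,\beta>0$, for each ball $B_r\subset\mathbb R^d$ with radius $r\in(0,2^{-1}e^{-3}]$ and each compact subset $E\subset B_r$, $$\mathcal H^{d-1}\Big\{a\in l^\perp:\ C_{h^{-1}_{\alpha,\beta}}(E\cap l_a)\ge k\,r^{-(d-1)}C_{F^{-1}_{\alpha,\beta}}(E)\Big\}\ge\frac{c\,C_{F^{-1}_{\alpha,\beta}}(E)}{h_{\alpha,\beta}(2r)} .$$
   Context: For $0<t\le e^{-3}$: $F_{\alpha,\beta}(t)=t^{d-1}(\log\frac1t)^{-\beta}(\log\log\frac1t)^{-\alpha}$ and $h_{\alpha,\beta}(t)=(\log\frac1t)^{-\beta}(\log\log\frac1t)^{-\alpha}$ (extended to larger $t$ as increasing continuous positive functions). For $f=F_{\alpha,\beta}$ or $f=h_{\alpha,\beta}$, $f^{-1}$ denotes $1/f$ and $C_{f^{-1}}$ is the capacity with kernel $K(x,y)=1/f(|x-y|)$ (equal to $+\infty$ if $x=y$): for a bounded Borel set $E\subset\mathbb R^d$, $$C_{f^{-1}}(E)=\sup\Big\{\Big(\int\!\!\int\frac{d\mu(x)\,d\mu(y)}{f(|x-y|)}\Big)^{-1}:\ \mu\text{ a Radon measure on }\mathbb R^d,\ \mathrm{supp}\,\mu\subset E,\ \mu(\mathbb R^d)=1\Big\},$$ with $1/\infty=0$ and $C_{f^{-1}}(\emptyset)=0$. $l^\perp$ is the orthogonal complement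 of $l$, $l_a=l+a$, and $\mathcal H^{d-1}$ is the $(d-1)$-dimensional Hausdorff measure.
   Formalization: The line l is chosen after α, β, the ball B_r and the set E (and may depend on them), since no single line works for all E; the constants c and k still depend only on d. *)

(* Defs.v *)
From HB Require Import structures.
From mathcomp Require Import all_boot all_order all_algebra.
From mathcomp Require Import all_classical all_reals all_analysis.

Set Implicit Arguments.
Unset Strict Implicit.
Unset Printing Implicit Defensive.

Import Order.TTheory GRing.Theory Num.Theory.
Import numFieldNormedType.Exports.

Local Open Scope classical_set_scope.
Local Open Scope ring_scope.

(* R^d is 'rV[R]_d. Its library topology is the usual one, but its library
   norm and balls are those of the sup norm, hence the Euclidean notions. *)
Definition dotv {R : realType} {d : nat} (u v : 'rV[R]_d) : R :=
  \sum_i u 0 i * v 0 i.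

Definition enorm {R : realType} {d : nat} (u : 'rV[R]_d) : R :=
  Num.sqrt (dotv u u).

(* The closed ball: a compact subset of an open ball of radius r is covered. *)
Definition eball {R : realType} {d : nat} (x : 'rV[R]_d) (r : R)
  : set 'rV[R]_d := [set y | enorm (y - x) <= r].

Definition perp {R : realType} {d : nat} (l : {vspace 'rV[R]_d})
  : set 'rV[R]_d := [set a | forall v, v \in l -> dotv v a = 0].

Definition translate {R : realType} {d : nat} (l : {vspace 'rV[R]_d})
  (a : 'rV[R]_d) : set 'rV[R]_d := [set v + a | v in [set` l]].

(* [maxe 0] only matters for the empty set, whose diameter is thus 0. *)
Definition ediam {R : realType} {d : nat} (A : set 'rV[R]_d) : \bar R :=
  maxe 0%E (ereal_sup [set (enorm (p.1 - p.2))%:E | p in A `*` A]).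

(* Hausdorff measure without normalizing constant, for an integer exponent
   s > 0, as an outer measure defined on all subsets of R^d. *)
Definition hausdorff_delta {R : realType} {d : nat} (s : nat) (delta : R)
  (A : set 'rV[R]_d) : \bar R :=
  ereal_inf [set (\sum_(0 <= i <oo) ediam (U i) ^+ s)%E
    | U in [set U : (set 'rV[R]_d)^nat |
             A `<=` \bigcup_i U i /\ forall i, (ediam (U i) <= delta%:E)%E]].

Definition hausdorff {R : realType} {d : nat} (s : nat) (A : set 'rV[R]_d)
  : \bar R :=
  ereal_sup [set hausdorff_delta s delta A | delta in [set e : R | 0 < e]].

Definition borelv (R : realType) (d : nat) :=
  g_sigma_algebraType (@open 'rV[R]_d).

Definition radon {R : realType} {d : nat}
  (mu : {measure set (borelv R d) -> \bar R}) : Prop :=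
  [/\ forall K : set 'rV[R]_d, compact K -> (mu K < +oo)%E,
      forall V : set 'rV[R]_d, open V ->
        mu V = ereal_sup [set mu K | K in
                 [set K : set 'rV[R]_d | compact K /\ K `<=` V]]
    & forall A : set (borelv R d), measurable A ->
        mu A = ereal_inf [set mu V | V in
                 [set V : set 'rV[R]_d | open V /\ A `<=` V]]].

Definition msupport {R : realType} {d : nat}
  (mu : {measure set (borelv R d) -> \bar R}) : set 'rV[R]_d :=
  [set x | forall V : set 'rV[R]_d, open V -> V x -> (0 < mu V)%E].

(* The kernel 1 / f(|x - y|). *)
Definition inv_kernel {R : realType} {d : nat} (f : R -> R) (x y : 'rV[R]_d)
  : \bar R := if x == y then +oo%E else ((f (enorm (x - y)))^-1)%:E.

Definition energy {R : realType} {d : nat} (f : R -> R)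
  (mu : {measure set (borelv R d) -> \bar R}) : \bar R :=
  (\int[mu]_y \int[mu]_x inv_kernel f x y)%E.

(* C_{f^-1}(E); the inverse is that of \bar R, for which (+oo)^-1 = 0. *)
Definition capacity {R : realType} {d : nat} (f : R -> R) (E : set 'rV[R]_d)
  : \bar R :=
  if E != set0 then
    ereal_sup [set ((energy f mu)^-1)%E
      | mu in [set mu : {measure set (borelv R d) -> \bar R} |
                [/\ radon mu, msupport mu `<=` E & mu setT = 1%E]]]
  else 0%E.

Definition F_gauge {R : realType} (d : nat) (alpha beta t : R) : R :=
  t ^+ d.-1 * ln t^-1 `^ (- beta) * ln (ln t^-1) `^ (- alpha).

Definition h_gauge {R : realType} (alpha beta t : R) : R :=
  ln t^-1 `^ (- beta) * ln (ln t^-1) `^ (- alpha).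

(* f is an increasing continuous positive function on ]0, +oo[ that extends
   the restriction of f0 to ]0, e^-3]. *)
Definition gauge_extension {R : realType} (f0 f : R -> R) : Prop :=
  [/\ forall t, 0 < t <= expR (- 3) -> f t = f0 t,
      forall t, 0 < t -> 0 < f t,
      forall s t, 0 < s -> s <= t -> f s <= f t
    & forall t, 0 < t -> {for t, continuous f}].

(* Main.v *)
(** Lines of direction [(1, w)], [w] in [[0, 1]^(d-1)], are parametrised by their
    trace [x' - w * x_0] on the hyperplane [x_0 = 0].  For two points at distance
    [t] the set of [w] for which these traces are [delta]-close has measure
    [O((delta / t)^(d-1))], so averaging over [w] turns the [F]-energy [J] of a
    nearly optimal measure into the sum of the [h]-energies of its restrictions to
    the [delta]-tubes, up to [delta^(d-1)].  For a suitable [w] at least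
    [c / (h(2r) J delta^(d-1))] tubes then carry a normalised restriction with
    [h]-energy at most [C r^(d-1) J].

    Everything up to this point is done with finitely many atoms and directions,
    at scales [delta = 1/N].  One passes to the limit [N -> oo] along an
    ultrafilter: directions and tubes converge, the distribution functions of the
    discrete measures converge to a continuous distribution function because
    [h(0+) = 0], and the energy bound survives on dyadic cells.  The set of limit
    tubes has large Hausdorff measure because, by compactness, each of its
    countable covers by open cubes contains almost all good tubes of some scale in
    finitely many cubes; counting replaces Lebesgue measure. *)

Require Import Defs.
From HB Require Import structures.
From mathcomp Require Import all_boot all_order all_algebra.
From mathcomp Require Import all_classical all_reals all_analysis.
From mathcomp Require Import measurable_realfun ring lra.

Set Implicit Arguments.
Unset Strict Implicit.
Unset Printing Implicit Defensive.

Import Order.TTheory GRing.Theory Num.Theory.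
Import numFieldNormedType.Exports.
Local Open Scope classical_set_scope.
Local Open Scope ring_scope.

(** Atoms make the average over directions a finite double sum, so neither Fubini for the singular
    kernel nor a disintegration of measures along lines is involved. The price is that atoms have
    infinite energy: the kernel is taken at distance |x - y| + 1/N, and this regularisation is
    carried along until the limit removes it. The distance is also capped by 2r, because F(t) =
    t^(d-1) h(t) is known only for t <= exp(-3); this is where the bound on r enters.

    A subsequence would not do in the passage to the limit. The covering argument selects a sequence
    of good tubes that depends on the cover, and its limit must be a limit tube for the direction
    already fixed. Along one ultrafilter every bounded sequence converges, whenever it is chosen.

    Hausdorff measure is bounded below directly through coverings, so the measurability of the set
    of good translates never has to be discussed. *)

(** * Euclidean inner product and norm *)

Lemma dotvC (R : realType) d (u v : 'rV[R]_d) : dotv u v = dotv v u.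
Proof. by apply: eq_bigr => i _; rewrite mulrC. Qed.

Lemma dotvDl (R : realType) d (u v w : 'rV[R]_d) :
  dotv (u + v) w = dotv u w + dotv v w.
Proof. by rewrite /dotv -big_split/=; apply: eq_bigr => i _; rewrite mxE mulrDl. Qed.

Lemma dotvZl (R : realType) d (c : R) (u w : 'rV[R]_d) :
  dotv (c *: u) w = c * dotv u w.
Proof. by rewrite /dotv mulr_sumr; apply: eq_bigr => i _; rewrite mxE mulrA. Qed.

Lemma dotvDr (R : realType) d (u v w : 'rV[R]_d) :
  dotv w (u + v) = dotv w u + dotv w v.
Proof. by rewrite dotvC dotvDl !(dotvC w). Qed.

Lemma dotvZr (R : realType) d (c : R) (u w : 'rV[R]_d) :
  dotv w (c *: u) = c * dotv w u.
Proof. by rewrite dotvC dotvZl (dotvC w). Qed.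

Lemma dotv_ge0 (R : realType) d (u : 'rV[R]_d) : 0 <= dotv u u.
Proof. by apply: sumr_ge0 => i _; rewrite -expr2 sqr_ge0. Qed.

Lemma cauchy_schwarz_dotv (R : realType) d (u v : 'rV[R]_d) :
  dotv u v ^+ 2 <= dotv u u * dotv v v.
Proof.
have := dotv_ge0 (dotv v v *: u + (- dotv u v) *: v).
rewrite !(dotvDl, dotvDr, dotvZl, dotvZr) (dotvC v u).
set a := dotv u u; set b := dotv u v; set c := dotv v v => H.
have {}H : 0 <= c * (a * c - b ^+ 2) by move: H; congr (0 <= _); ring.
have [c0|c0] := eqVneq c 0; last first.
  have cp : 0 < c by rewrite lt_neqAle eq_sym c0 dotv_ge0.
  by move: H; rewrite pmulr_rge0// subr_ge0.
suff -> : b = 0 by rewrite c0 mulr0 expr0n.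
apply: big1 => i _; suff -> : v 0 i = 0 by rewrite mulr0.
apply/eqP; rewrite -sqrf_eq0 expr2; apply/eqP.
by apply: (psumr_eq0P (F := fun i => v 0 i * v 0 i)) c0 i _ => // j _; rewrite -expr2 sqr_ge0.
Qed.

Lemma enorm_ge0 (R : realType) d (u : 'rV[R]_d) : 0 <= enorm u.
Proof. exact: sqrtr_ge0. Qed.

Lemma sqr_enorm (R : realType) d (u : 'rV[R]_d) : enorm u ^+ 2 = dotv u u.
Proof. by rewrite sqr_sqrtr// dotv_ge0. Qed.

Lemma ler_enormD (R : realType) d (u v : 'rV[R]_d) :
  enorm (u + v) <= enorm u + enorm v.
Proof.
rewrite -(@ler_pXn2r _ 2)// ?nnegrE ?addr_ge0 ?enorm_ge0//.
rewrite sqrrD !sqr_enorm dotvDl !dotvDr (dotvC v u).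
suff : dotv u v <= enorm u * enorm v by lra.
apply: le_trans (ler_norm _) _.
rewrite -(@ler_pXn2r _ 2)// ?nnegrE ?mulr_ge0 ?enorm_ge0//.
by rewrite real_normK ?num_real// exprMn !sqr_enorm cauchy_schwarz_dotv.
Qed.

Lemma enormZ (R : realType) d (c : R) (u : 'rV[R]_d) :
  enorm (c *: u) = `|c| * enorm u.
Proof.
by rewrite /enorm dotvZl dotvZr mulrA -expr2 sqrtrM ?sqr_ge0// sqrtr_sqr.
Qed.

Lemma enormN (R : realType) d (u : 'rV[R]_d) : enorm (- u) = enorm u.
Proof. by rewrite -scaleN1r enormZ normrN1 mul1r. Qed.

Lemma enormB (R : realType) d (u v : 'rV[R]_d) : enorm (u - v) = enorm (v - u).
Proof. by rewrite -enormN opprB. Qed.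

Lemma ler_coord_enorm (R : realType) d (u : 'rV[R]_d) i : `|u 0 i| <= enorm u.
Proof.
rewrite -(@ler_pXn2r _ 2)// ?nnegrE ?enorm_ge0//.
rewrite real_normK ?num_real// sqr_enorm /dotv (bigD1 i)//= -expr2 lerDl.
by apply: sumr_ge0 => j _; rewrite -expr2 sqr_ge0.
Qed.

Lemma ler_enorm_sum (R : realType) d (u : 'rV[R]_d) :
  enorm u <= \sum_i `|u 0 i|.
Proof.
rewrite -(@ler_pXn2r _ 2)// ?nnegrE ?enorm_ge0 ?sumr_ge0//.
rewrite sqr_enorm expr2 mulr_suml; apply: ler_sum => i _.
rewrite -expr2 -(real_normK (num_real (u 0 i))) expr2 ler_wpM2l// (bigD1 i)//= lerDl.
exact: sumr_ge0.
Qed.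

Lemma enorm_gt0 (R : realType) d (u : 'rV[R]_d) : u != 0 -> 0 < enorm u.
Proof.
move=> u0; rewrite lt_neqAle enorm_ge0 andbT eq_sym; apply: contra_neq u0 => u0.
apply/rowP => k; rewrite [RHS]mxE; apply/eqP.
by rewrite -normr_le0 -u0 ler_coord_enorm.
Qed.

(** * Nonnegative kernels and their integrals *)

Lemma inv_kernel_ge0 (R : realType) d (f : R -> R) (x y : 'rV[R]_d) :
  (forall t, 0 < t -> 0 < f t) -> (0 <= inv_kernel f x y)%E.
Proof.
move=> f0; rewrite /inv_kernel; case: eqVneq => // xy.
by rewrite lee_fin invr_ge0 ltW// f0// enorm_gt0// subr_eq0.
Qed.

(** The integral of a nonnegative function is a supremum over simple functions below it, so no
    measurability is required. This matters for energies, whose inner integral is never shown to be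
    measurable. *)
Lemma ge0_le_integral_nomeas (R : realType) dd (T : measurableType dd)
    (mu : {measure set T -> \bar R}) (f g : T -> \bar R) :
  (forall x, 0 <= f x)%E -> (forall x, f x <= g x)%E ->
  (\int[mu]_x f x <= \int[mu]_x g x)%E.
Proof.
move=> f0 fg; rewrite !ge0_integralTE//; last first.
  by move=> x; exact: le_trans (f0 x) (fg x).
apply: ge_ereal_sup => _ [k /= kf <-]; apply: ereal_sup_ubound.
by exists k => // x; exact: le_trans (kf x) (fg x).
Qed.

(** * Supports and regularity of Borel measures *)

Lemma open_measurable_borelv (R : realType) d (V : set 'rV[R]_d) :
  open V -> measurable (V : set (borelv R d)).
Proof. exact: sub_sigma_algebra. Qed.

Lemma closed_measurable_borelv (R : realType) d (C : set 'rV[R]_d) :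
  closed C -> measurable (C : set (borelv R d)).
Proof.
move=> cC; rewrite -(setCK C); apply: measurableC.
by apply: open_measurable_borelv; exact: closed_openC.
Qed.

(** Inner regularity on the open complement of [E] reduces the claim to compact sets, each of which
    is covered by finitely many open null sets. *)
Lemma measure_setC_msupport (R : realType) d
    (mu : {measure set (borelv R d) -> \bar R}) (E : set 'rV[R]_d) :
  radon mu -> closed E -> msupport mu `<=` E -> mu (~` E) = 0%E.
Proof.
move=> [_ inner _] cE sE; have oE : open (~` E) by exact: closed_openC.
apply/eqP; rewrite -measure_le0 [X in (X <= _)%E](inner _ oE); apply: ge_ereal_sup => _ [K [cK KE] <-].
have {}sE x : exists W, K x -> [/\ open W, W x & mu W = 0%E].
  have [Kx|nKx] := pselect (K x); last by exists set0.
  apply: contrapT => H; apply: (KE _ Kx); apply: sE => V oV Vx.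
  rewrite lt_neqAle measure_ge0 andbT; apply/eqP => V0.
  by apply: H; exists V => _; split.
have [W WP] := choice sE.
move: (cK); rewrite compact_cover => /(_ _ K W)[].
- by move=> x /WP[].
- by move=> x Kx; exists x => //; have [] := WP x Kx.
move=> D' DK; rewrite /cover bigcup_fset => KW.
have {}DK i : i \in finmap.enum_fset D' -> K i by move=> iD; exact: set_mem (DK i iD).
move: (finmap.enum_fset D') KW DK => s KW sK.
have [mU U0] : measurable (\big[setU/set0]_(i <- s) W i : set (borelv R d)) /\
    mu (\big[setU/set0]_(i <- s) W i) = 0%E.
  rewrite big_seq; elim/big_ind : _ => [|A B [mA A0] [mB B0]|i iD].
  - by split; [exact: measurable0|exact: measure0].
  - by split; [exact: measurableU|rewrite measureU0].
  - have [oW _ W0] := WP i (sK i iD).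
    by split => //; exact: open_measurable_borelv.
rewrite -U0 le_measure ?inE//; apply: closed_measurable_borelv.
by apply: compact_closed cK; exact: norm_hausdorff.
Qed.

Lemma compact_approx (R : realType) d (mu : {measure set (borelv R d) -> \bar R})
    (V : set 'rV[R]_d) (eps : R) :
  (mu setT < +oo)%E -> open V -> 0 < eps ->
  exists K, [/\ compact K, K `<=` V & (mu (V `\` K) <= eps%:E)%E].
Proof.
move=> muoo oV e0.
(* Exhaustion of [V] by closed bounded sets: points of norm at most [n] whose ball of radius
   [1 / (n + 1)] stays inside [V]. *)
pose K n := [set x : 'rV[R]_d | `|x| <= n%:R /\ ball x n.+1%:R^-1 `<=` V].
have cK n : closed (K n).
  rewrite (_ : K n = [set x | `|x| <= n%:R] `&`
      \bigcap_(y in ~` V) ~` ball y n.+1%:R^-1); last first.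
    apply/seteqP; split=> x [xn xV]; split => //.
      by move=> y Vy /ball_sym /xV.
    by move=> y xy; apply: contrapT => Vy; exact: (xV y Vy (ball_sym xy)).
  apply: closedI.
    apply: (@preimage_closed _ _ (fun x : 'rV[R]_d => `|x|) [set y | y <= n%:R]);
      last exact: closed_le.
    by move=> x _; exact: norm_continuous.
  by apply: closed_bigI => y _; apply: open_closedC; exact: ball_open.
have KV n : K n `<=` V.
  by move=> x [_]; apply; exact: ballxx.
have mK n : measurable (K n : set (borelv R d)) by exact: closed_measurable_borelv.
have mV : measurable (V : set (borelv R d)) by exact: open_measurable_borelv.
pose F n : set (borelv R d) := V `\` K n.
have mF n : measurable (F n) by exact: measurableD.
have F0 : \bigcap_n F n = set0.
  apply/seteqP; split => // x Fx.
  have [Vx _] := Fx 0%N I.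
  have /nbhs_ballP[e /= e_gt0 xe] : nbhs x V by exact: open_nbhs_nbhs.
  have [n1 xn1] : exists n : nat, `|x| <= n%:R.
    by exists (Num.bound `|x|); rewrite ltW// (le_lt_trans _ (archi_boundP _))// ?normr_ge0// ler_norm.
  have [n2 en2] : exists n : nat, n.+1%:R^-1 <= e.
    exists (Num.bound e^-1); rewrite invf_ple ?posrE// ltW//.
    by rewrite (lt_trans (archi_boundP _)) ?invr_ge0 ?(ltW e_gt0)// ltr_nat.
  have [_] := Fx (maxn n1 n2) I; apply; split.
    by rewrite (le_trans xn1)// ler_nat leq_maxl.
  apply: subset_trans xe; apply: le_ball; apply: le_trans en2.
  by rewrite lef_pV2 ?posrE// ler_nat ltnS leq_maxr.
have : mu \o F @ \oo --> mu (\bigcap_n F n).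
  apply: nonincreasing_cvg_mu => //.
  - rewrite (le_lt_trans _ muoo)// le_measure ?inE//.
  - by rewrite F0; exact: measurable0.
  - move=> m n mn; apply/subsetPset => x [Vx nK]; split => // -[xm xV].
    apply: nK; split; first by rewrite (le_trans xm)// ler_nat.
    by apply: subset_trans xV; apply: le_ball; rewrite lef_pV2 ?posrE// ler_nat ltnS.
rewrite F0 measure0 => cvF.
have : \forall n \near \oo, (mu (F n) < eps%:E)%E.
  by apply: (cvF [set x | (x < eps%:E)%E]); apply: open_ereal_lt'; rewrite lte_fin.
move=> [n _ /(_ n (leqnn n))/= Fn]; exists (K n); split => //; last exact: ltW.
apply: bounded_closed_compact => //; exists n%:R; split; first exact: num_real.
by move=> x nx y [yn _]; exact: le_trans yn (ltW nx).
Qed.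

(** The sets that can be approximated in this way form a sigma-algebra containing the open sets; a
    complement exchanges the roles of [C] and [V]. *)
Lemma borel_regular (R : realType) d (mu : {measure set (borelv R d) -> \bar R})
    (A : set (borelv R d)) : (mu setT < +oo)%E -> measurable A ->
  forall eps : R, 0 < eps -> exists C V : set 'rV[R]_d,
    [/\ closed C, open V, C `<=` A, A `<=` V & (mu (V `\` C) <= eps%:E)%E].
Proof.
move=> muoo mA.
pose D := [set A : set 'rV[R]_d | forall eps : R, 0 < eps ->
  exists C V : set 'rV[R]_d,
    [/\ closed C, open V, C `<=` A, A `<=` V & (mu (V `\` C) <= eps%:E)%E]].
suff : <<s @open 'rV[R]_d >> `<=` D by move=> /(_ A mA).
have mVC (C V : set 'rV[R]_d) : closed C -> open V ->
    measurable (V `\` C : set (borelv R d)).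
  move=> cC oV; apply: measurableD; first exact: open_measurable_borelv.
  exact: closed_measurable_borelv.
apply: smallest_sub; last first.
  move=> V oV eps e0; have [K [cK KV Ke]] := compact_approx muoo oV e0.
  by exists K, V; split => //; apply: compact_closed cK; exact: norm_hausdorff.
split.
- move=> eps e0; exists set0, set0; split; [exact: closed0|exact: open0|by []|by []|].
  by rewrite setD0 measure0 lee_fin ltW.
- move=> B DB eps e0; have [C [V [cC oV CB BV VC]]] := DB _ e0.
  exists (~` V), (~` C); split; [exact: open_closedC|exact: closed_openC| | |].
  + by move=> x Vx; split => // /BV.
  + by move=> x [_ Bx] /CB.
  + apply: le_trans VC; rewrite (_ : ~` C `\` ~` V = V `\` C)//.
    by rewrite setDE setCK setIC.
- move=> B DB eps e0.
  have e20 : 0 < eps / 2 by rewrite divr_gt0.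
  have en0 n : 0 < eps / 2 / (2 ^ n.+1)%:R by rewrite divr_gt0// ltr0n expn_gt0.
  have [C] := choice (fun n => DB n _ (en0 n)).
  move=> /choice[V CV].
  pose W := \bigcup_n V n.
  have oW : open W by apply: bigcup_open => n _; have [] := CV n.
  (* A countable union of closed sets need not be closed, so it is truncated; continuity from above
     makes the loss small. *)
  pose F n : set 'rV[R]_d := W `\` \big[setU/set0]_(i < n) C i.
  have cU n : closed (\big[setU/set0]_(i < n) C i).
    by elim/big_ind : _ => [|X Y|i _]; [exact: closed0|exact: closedU|have [] := CV i].
  have mC n : measurable (C n : set (borelv R d)).
    by have [+ _ _ _ _] := CV n; exact: closed_measurable_borelv.
  have capF : \bigcap_n F n = W `\` \bigcup_n C n.
    apply/seteqP; split=> [x Fx|x [Wx nC] n _]; split => //.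
    + by have [] := Fx 0%N I.
    + move=> [n _ Cnx]; have [_] := Fx n.+1 I; apply.
      by rewrite -bigcup_mkord; exists n => //=.
    + by rewrite -bigcup_mkord => -[i _ ix]; apply: nC; exists i.
  have mcapF : measurable (W `\` \bigcup_n C n : set (borelv R d)).
    apply: measurableD; first exact: open_measurable_borelv.
    exact: bigcup_measurable.
  have small : (mu (W `\` \bigcup_n C n) < eps%:E)%E.
    apply: (@le_lt_trans _ _ (eps / 2)%:E); last by rewrite lte_fin ltr_pdivrMr// ltr_pMr// ltr1n.
    apply: le_trans (epsilon_trick0 xpredT (ltW e20)).
    apply: (@le_trans _ _ (\sum_(n <oo) mu (V n `\` C n))%E).
      apply: measure_sigma_subadditive => //.
        by move=> n; have [cC oV _ _ _] := CV n; exact: mVC.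
      by move=> x [[n _ Vx] nC]; exists n => //; split => // Cx; apply: nC; exists n.
    apply: lee_nneseries => // n _; first by have [] := CV n.
  have cvF : mu \o F @ \oo --> mu (\bigcap_n F n).
    apply: nonincreasing_cvg_mu => //.
    + by rewrite (le_lt_trans _ muoo)// le_measure ?inE//; exact: mVC.
    + by move=> i; exact: mVC.
    + by rewrite capF.
    + move=> m n mn; apply/subsetPset => x [Wx nC]; split => // Cx; apply: nC.
      move: Cx; rewrite -!bigcup_mkord => -[i /= im Ci]; exists i => //=.
      exact: leq_trans im mn.
  rewrite capF in cvF.
  have : \forall n \near \oo, (mu (F n) < eps%:E)%E.
    by apply: (cvF [set x | (x < eps%:E)%E]); exact: open_ereal_lt'.
  move=> [n _ /(_ n (leqnn n))/= Fn].
  exists (\big[setU/set0]_(i < n) C i), W; split => //; last exact: ltW.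
  + rewrite -bigcup_mkord => x [i _ Cx]; exists i => //.
    by have [_ _ CB _ _] := CV i; exact: CB.
  + by move=> x [i _ Bx]; exists i => //; have [_ _ _ BV _] := CV i; exact: BV.
Qed.

(** Makes the limit measure on a slice an admissible competitor in [capacity]. *)
Lemma finite_measure_radon (R : realType) d
    (mu : {measure set (borelv R d) -> \bar R}) : (mu setT < +oo)%E -> radon mu.
Proof.
move=> muoo.
have fin (A : set (borelv R d)) : measurable A -> mu A \is a fin_num.
  by move=> mA; rewrite ge0_fin_numE// (le_lt_trans _ muoo)// le_measure ?inE.
have split_mu (V C : set 'rV[R]_d) (eps : R) :
    measurable (V : set (borelv R d)) -> measurable (C : set (borelv R d)) ->
    C `<=` V -> (mu (V `\` C) <= eps%:E)%E -> (mu V <= mu C + eps%:E)%E.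
  move=> mV mC CV VC; apply: le_trans (leeD2l _ VC).
  rewrite -measureU ?setDIK//; last exact: measurableD.
  by rewrite setDUK.
have mK (K : set 'rV[R]_d) : compact K -> measurable (K : set (borelv R d)).
  by move=> cK; apply: closed_measurable_borelv; apply: compact_closed cK; exact: norm_hausdorff.
split.
- by move=> K cK; rewrite (le_lt_trans _ muoo)// le_measure ?inE//; exact: mK.
- move=> V oV; apply/eqP; rewrite eq_le; apply/andP; split.
    apply/lee_addgt0Pr => eps e0.
    have [K [cK KV Ke]] := compact_approx muoo oV e0.
    apply: le_trans (split_mu _ _ _ (open_measurable_borelv oV) (mK _ cK) KV Ke) _.
    by apply: leeD2r; apply: ereal_sup_ubound; exists K.
  apply: ge_ereal_sup => _ [K [cK KV] <-].
  by rewrite le_measure ?inE//; [exact: mK|exact: open_measurable_borelv].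
- move=> A mA; apply/eqP; rewrite eq_le; apply/andP; split.
    apply: le_ereal_inf_tmp => _ [V [oV AV] <-].
    by rewrite le_measure ?inE//; exact: open_measurable_borelv.
  apply/lee_addgt0Pr => eps e0.
  have [C [V [cC oV CA AV VC]]] := borel_regular muoo mA e0.
  apply: (@le_trans _ _ (mu V)); first by apply: ereal_inf_lbound; exists V.
  apply: le_trans (split_mu _ _ _ (open_measurable_borelv oV)
    (closed_measurable_borelv cC) (subset_trans CA AV) VC) _.
  by apply: leeD2r; rewrite le_measure ?inE//; exact: closed_measurable_borelv.
Qed.

(** * Step functions and discretisation of the energy *)

Definition stepfun (R : realType) (T : Type) (D : nat -> set T) (a : nat -> R) n
    (x : T) : \bar R := (\sum_(i < n) (a i * \1_(D i) x)%:E)%E.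

Lemma stepfun_ge0 (R : realType) (T : Type) (D : nat -> set T) (a : nat -> R) n x :
  (forall i, 0 <= a i) -> (0 <= stepfun D a n x)%E.
Proof. by move=> a0; apply: sume_ge0 => i _; rewrite lee_fin mulr_ge0. Qed.

Lemma stepfunE (R : realType) (T : Type) (D : nat -> set T) (a : nat -> R) n i x :
  trivIset setT D -> (i < n)%N -> D i x -> stepfun D a n x = (a i)%:E.
Proof.
move=> tD ilt Dx; rewrite /stepfun (bigD1 (Ordinal ilt))//= indicE mem_set// mulr1.
rewrite big1 ?adde0// => j /eqP ij; rewrite indicE memNset ?mulr0// => Djx.
apply: ij; apply: val_inj => /=.
by apply: tD => //; exists x.
Qed.

Lemma stepfun_out (R : realType) (T : Type) (D : nat -> set T) (a : nat -> R) n x :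
  (forall i, (i < n)%N -> ~ D i x) -> stepfun D a n x = 0%E.
Proof.
by move=> Dx; rewrite /stepfun big1// => j _; rewrite indicE memNset ?mulr0//; exact: Dx.
Qed.

Lemma measurable_stepfun (R : realType) dd (T : measurableType dd)
    (D : nat -> set T) (a : nat -> R) n :
  (forall i, measurable (D i)) -> measurable_fun [set: T] (fun x : T => stepfun D a n x).
Proof.
move=> mD; apply: emeasurable_sum => i.
apply/measurable_EFinP; apply: measurable_funM => //.
Qed.

Lemma integral_stepfun (R : realType) dd (T : measurableType dd)
    (mu : {measure set T -> \bar R}) (D : nat -> set T) (a : nat -> R) n :
  (forall i, measurable (D i)) -> (forall i, 0 <= a i) ->
  (\int[mu]_x stepfun D a n x = \sum_(i < n) (a i)%:E * mu (D i))%E.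
Proof.
move=> mD a0; rewrite ge0_integral_sum//; last 2 first.
- move=> i; apply/measurable_EFinP; exact: measurable_funM.
- by move=> i x _; rewrite lee_fin mulr_ge0.
apply: eq_bigr => i _; under eq_integral do rewrite EFinM.
rewrite ge0_integralZl_EFin//; last exact/measurable_EFinP.
by rewrite integral_indic// setIT.
Qed.

Lemma le_stepfun_integral (R : realType) dd (T : measurableType dd)
    (mu : {measure set T -> \bar R}) (D : nat -> set T) (a : nat -> R) n
    (f : T -> \bar R) :
  (forall i, measurable (D i)) -> trivIset setT D -> (forall i, 0 <= a i) ->
  (forall x, 0 <= f x)%E ->
  (forall i x, (i < n)%N -> D i x -> ((a i)%:E <= f x)%E) ->
  (\sum_(i < n) (a i)%:E * mu (D i) <= \int[mu]_x f x)%E.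
Proof.
move=> mD tD a0 f0 af; rewrite -integral_stepfun//.
apply: ge0_le_integral_nomeas => x; first exact: stepfun_ge0.
have [[i [ilt Dx]]|H] := pselect (exists i, (i < n)%N /\ D i x).
  by rewrite (stepfunE _ tD ilt Dx); exact: af.
by rewrite stepfun_out// => i ilt Dx; apply: H; exists i.
Qed.

(** [E] is cut into cells, each within [eps / 2] of its atom, and an atom receives the mass of its
    cell. Two points of [E] are at distance at most [eps] more than their atoms, and at most
    [2 * r], so on a product of cells the kernel dominates its regularised value at the atoms. *)
Lemma discrete_energy (R : realType) d (mu : {measure set (borelv R d) -> \bar R})
    (F : R -> R) (E : set 'rV[R]_d) (x0 : 'rV[R]_d) (r J eps : R) :
  radon mu -> msupport mu `<=` E -> mu setT = 1%E ->
  compact E -> E `<=` eball x0 r -> 0 < r ->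
  (forall t, 0 < t -> 0 < F t) ->
  (forall s t, 0 < s -> s <= t -> F s <= F t) ->
  (energy F mu <= J%:E)%E -> 0 < eps ->
  exists n (x : nat -> 'rV[R]_d) (p : nat -> R),
  [/\ forall i, (i < n)%N -> E (x i), forall i, 0 <= p i, \sum_(i < n) p i = 1 &
    \sum_(i < n) \sum_(j < n) p i * p j *
      (F (Num.min (enorm (x i - x j) + eps) (2 * r)))^-1 <= J].
Proof.
move=> rmu sE mu1 cE Er r0 F0 Fmono eJ e0.
have clE : closed E by apply: compact_closed cE; exact: norm_hausdorff.
have muEc := measure_setC_msupport rmu clE sE.
have mE : measurable (E : set (borelv R d)) by exact: closed_measurable_borelv.
(* Library balls are sup-norm balls, and the Euclidean norm is at most the sum of the [d]
   coordinates; [d.+1] keeps the radius positive for [d = 0] too. *)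
pose eta := eps / (2 * d.+1%:R).
have eta0 : 0 < eta by rewrite divr_gt0// mulr_gt0.
have enorm_ball (u v : 'rV[R]_d) : ball u eta v -> enorm (u - v) <= eps / 2.
  move=> [_ uv]; apply: le_trans (ler_enorm_sum _) _.
  apply: (@le_trans _ _ (\sum_(i < d) eta)).
    by apply: ler_sum => i _; rewrite !mxE ltW//; exact: uv.
  rewrite sumr_const card_ord -[eta *+ d]mulr_natl.
  have -> : d%:R * eta = eps / 2 * (d%:R / d.+1%:R).
    by rewrite /eta; field; rewrite addrC natr1 pnatr_eq0.
  by rewrite ler_piMr ?divr_ge0 ?(ltW e0)// ler_pdivrMr// mul1r ler_nat.
move: (cE); rewrite compact_cover => /(_ _ E (fun x => ball x eta))[].
- by move=> x _; exact: ball_open.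
- by move=> x Ex; exists x => //; exact: ballxx.
move=> D' DE; rewrite /cover bigcup_fset => EU.
have {}DE i : i \in finmap.enum_fset D' -> E i by move=> /DE/set_mem.
move: (finmap.enum_fset D') EU DE => s EU sE'.
pose n := size s; pose x i := nth 0 s i.
pose B i : set (borelv R d) := E `&` ball (x i) eta.
pose D := seqDU B.
have mB i : measurable (B i).
  by apply: measurableI => //; apply: open_measurable_borelv; exact: ball_open.
have mD i : measurable (D i).
  by apply: measurableD => //; exact: bigsetU_measurable.
have tD : trivIset setT D by exact: trivIset_seqDU.
have DB i : D i `<=` B i by exact: subset_seqDU.
pose p i := fine (mu (D i)).
have muD i : mu (D i) = (p i)%:E.
  rewrite fineK// ge0_fin_numE// (@le_lt_trans _ _ (mu setT))//.
    by rewrite le_measure ?inE//; exact: measurableT.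
  by rewrite mu1 ltry.
have p0 i : 0 <= p i by rewrite -lee_fin -muD.
have sump : \sum_(i < n) p i = 1.
  apply: EFin_inj; rewrite -sumEFin; under eq_bigr do rewrite -muD.
  rewrite -(measure_bigsetU_ord _ xpredT)//=; last first.
    by move=> i j _ _ Hij; apply: val_inj; exact: tD.
  transitivity (mu setT); last exact: mu1.
  rewrite -(setUv E) measureU0//; last exact: measurableC.
  congr (mu _); rewrite -(bigsetU_seqDU B n).
  apply/seteqP; split=> [y|y Ey].
    by rewrite -bigcup_mkord => -[i _ []].
  have : (\big[setU/set0]_(i <- s) ball i eta) y by exact: EU.
  rewrite -bigcup_seq => -[z /= zs yz]; rewrite -bigcup_mkord.
  by exists (index z s); rewrite /= ?index_mem// /B /x nth_index.
exists n, x, p; split => //.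
  by move=> i ilt; apply: sE'; exact: mem_nth.
pose kap i j := (F (Num.min (enorm (x i - x j) + eps) (2 * r)))^-1.
have m0 i j : 0 < Num.min (enorm (x i - x j) + eps) (2 * r).
  by rewrite lt_min mulr_gt0// ltr_wpDl// enorm_ge0.
have kap0 i j : 0 <= kap i j by rewrite invr_ge0 ltW// F0.
have K0 (u v : 'rV[R]_d) : (0 <= inv_kernel F u v)%E by exact: inv_kernel_ge0.
have kapK i j u v : D i u -> D j v -> ((kap i j)%:E <= inv_kernel F u v)%E.
  move=> /DB[Eu ui] /DB[Ev vj]; rewrite /inv_kernel; case: eqVneq => [|uv].
    by rewrite leey.
  have uv0 : 0 < enorm (u - v) by rewrite enorm_gt0// subr_eq0.
  rewrite lee_fin lef_pV2 ?posrE ?F0//; apply: Fmono => //.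
  rewrite le_min; apply/andP; split.
    have -> : u - v = - (x i - u) + ((x i - x j) + (x j - v)).
      by apply/rowP => k; rewrite !mxE; ring.
    have := ler_enormD (- (x i - u)) ((x i - x j) + (x j - v)).
    have := ler_enormD (x i - x j) (x j - v).
    rewrite enormN; have := enorm_ball _ _ ui; have := enorm_ball _ _ vj.
    lra.
  have := ler_enormD (u - x0) (x0 - v); rewrite addrA subrK (enormB x0 v).
  by have := Er _ Eu; have := Er _ Ev; rewrite /eball/=; lra.
rewrite -lee_fin; apply: le_trans eJ; rewrite /energy.
have inner_ge0 v : (0 <= \int[mu]_u inv_kernel F u v)%E by exact: integral_ge0.
have cell j v : D j v -> ((\sum_(i < n) p i * kap i j)%:E <= \int[mu]_u inv_kernel F u v)%E.
  move=> Djv; apply: le_trans (@le_stepfun_integral _ _ _ mu D (kap^~ j) n _ mD tD _ _ _) => //.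
    by rewrite -sumEFin; apply: lee_sum => i _; rewrite muD -EFinM mulrC.
  by move=> i u _ Diu; exact: kapK.
apply: le_trans (@le_stepfun_integral _ _ _ mu D
   (fun j => \sum_(i < n) p i * kap i j) n _ mD tD _ _ _) => //.
- rewrite exchange_big/= -sumEFin; apply: lee_sum => j _; rewrite muD -EFinM lee_fin.
  by rewrite mulr_suml; apply: ler_sum => i _; rewrite mulrAC.
- by move=> j; apply: sumr_ge0 => i _; rewrite mulr_ge0.
- by move=> j v _; exact: cell.
Qed.

(** * Limits along an ultrafilter *)

Lemma ultra_fmap (T T' : Type) (f : T -> T') (U : set_system T) :
  UltraFilter U -> UltraFilter (f @ U).
Proof.
move=> UU; split; first exact: fmap_proper_filter.
move=> G PG sUG; apply/seteqP; split => // A GA.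
have [//|UnA] := in_ultra_setVsetC (f @^-1` A) UU.
have GnA : G (~` A) by exact: sUG.
by have [z []] := @filter_ex _ _ PG _ (filterI GA GnA).
Qed.

Lemma ultra_cvg (R : realType) (U : set_system nat) (u : nat -> R) (B : R) :
  UltraFilter U -> (forall n, `|u n| <= B) -> exists l : R, u @ U --> l.
Proof.
move=> UU uB; have := @segment_compact R (- B) B.
rewrite compact_ultra => /(_ (u @ U) (ultra_fmap u UU))[|l [_ ul]].
  by apply: (@filterE _ U) => n /=; rewrite in_itv/= -ler_norml.
by exists l.
Qed.

Lemma cvg_sumr (R : realType) (T I : Type) (U : set_system T) (r : seq I)
    (f : I -> T -> R) (l : I -> R) : Filter U ->
  (forall i, f i @ U --> l i) ->
  (fun n => \sum_(i <- r) f i n) @ U --> \sum_(i <- r) l i.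
Proof.
move=> FU fl; elim: r => [|i r IH].
  by under eq_fun do rewrite big_nil; rewrite big_nil; exact: cvg_cst.
under eq_fun do rewrite big_cons; rewrite big_cons; exact: cvgD.
Qed.

(** * Lines and discrete measures concentrating on them *)

Definition dirv (R : realType) e (w : 'I_e -> R) : 'rV[R]_e.+1 :=
  \row_i (if unlift ord0 i is Some k then w k else 1).

Lemma dirv0 (R : realType) e (w : 'I_e -> R) : dirv w 0 0 = 1.
Proof. by rewrite mxE unlift_none. Qed.

Lemma dirvS (R : realType) e (w : 'I_e -> R) k : dirv w 0 (lift ord0 k) = w k.
Proof. by rewrite mxE liftK. Qed.

Lemma enorm_dirv_ge1 (R : realType) e (w : 'I_e -> R) : 1 <= enorm (dirv w).
Proof. by have := ler_coord_enorm (dirv w) 0; rewrite dirv0 normr1. Qed.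

Definition graph_line (R : realType) e (w y : 'I_e -> R) : set 'rV[R]_e.+1 :=
  [set x | forall k, x 0 (lift ord0 k) = w k * x 0 0 + y k].

(** What the limit argument uses of [h]. The field [gauge_small] says h(0+) = 0: it prevents atoms
    in the limit and makes the step kernels blow up on the diagonal. *)
Record gauge (R : realType) (h : R -> R) : Prop := Gauge {
  gauge_gt0 : forall t, 0 < t -> 0 < h t;
  gauge_mono : forall s t, 0 < s -> s <= t -> h s <= h t;
  gauge_cont : forall t, 0 < t -> {for t, continuous h};
  gauge_small : forall eps, 0 < eps -> exists2 t, 0 < t & h t <= eps }.

(** A discrete substitute for measures converging weakly to a measure on the slice. Only atoms of
    nonzero weight must approach the line: at each scale all tubes share the atoms [x n] and differ
    in the weights. The term [del n] keeps the diagonal finite. *)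
Record slice_approx (R : realType) e (h : R -> R) (E : set 'rV[R]_e.+1)
    (w y : 'I_e -> R) (M : R) (U : set_system nat) (N : nat -> nat)
    (x : nat -> nat -> 'rV[R]_e.+1) (p : nat -> nat -> R) (del : nat -> R) : Prop :=
  SliceApprox {
  sa_in : forall n i, (i < N n)%N -> E (x n i);
  sa_ge0 : forall n i, 0 <= p n i;
  sa_sum : forall n, \sum_(i < N n) p n i = 1;
  sa_line : forall eta, 0 < eta -> \forall n \near U,
    forall i, (i < N n)%N -> p n i != 0 -> forall k,
    `|x n i 0 (lift ord0 k) - w k * x n i 0 0 - y k| <= eta;
  sa_del0 : forall n, 0 < del n;
  sa_del : forall eta, 0 < eta -> \forall n \near U, del n <= eta;
  sa_energy : forall n, \sum_(i < N n) \sum_(j < N n)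
    p n i * p n j * (h (enorm (x n i - x n j) + del n))^-1 <= M }.

Lemma enorm_near_line (R : realType) e (w y : 'I_e -> R) (u v : 'rV[R]_e.+1) eta :
  (forall k, `|u 0 (lift ord0 k) - w k * u 0 0 - y k| <= eta) ->
  (forall k, `|v 0 (lift ord0 k) - w k * v 0 0 - y k| <= eta) ->
  enorm (u - v) <= enorm (dirv w) * `|u 0 0 - v 0 0| + 2 * e%:R * eta.
Proof.
move=> ue ve; rewrite mulrC -enormZ.
set q := (_ *: dirv w); rewrite -[u - v](subrKC q).
apply: le_trans (ler_enormD _ _) _; rewrite lerD2l.
apply: le_trans (ler_enorm_sum _) _.
rewrite big_ord_recl !mxE unlift_none mulr1 subrr normr0 add0r.
apply: (@le_trans _ _ (\sum_(k < e) 2 * eta)); last first.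
  by rewrite sumr_const card_ord -[leLHS]mulr_natl mulrCA mulrA.
apply: ler_sum => k _; rewrite !mxE liftK.
have := ue k; have := ve k; rewrite !ler_norml; lra.
Qed.

(** * The limit distribution function *)

Definition cdf (R : realType) e (N : nat -> nat) (x : nat -> nat -> 'rV[R]_e.+1)
  (p : nat -> nat -> R) n (t : R) : R := \sum_(i < N n | x n i 0 0 <= t) p n i.

Lemma cdf_sub (R : realType) e N (x : nat -> nat -> 'rV[R]_e.+1) p n a b :
  a <= b ->
  cdf N x p n b - cdf N x p n a = \sum_(i < N n | a < x n i 0 0 <= b) p n i.
Proof.
move=> ab; rewrite /cdf (bigID (fun i : 'I_(N n) => x n i 0 0 <= a))/=.
rewrite (eq_bigl (fun i : 'I_(N n) => x n i 0 0 <= a)); last first.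
  by move=> i; rewrite andb_idl// => /le_trans; exact.
by rewrite addrAC subrr add0r; apply: eq_bigl => i; rewrite -ltNge andbC.
Qed.

(* In the energy bound, [c s] is the index of the cell [(l a, r a]] containing [s]. *)
Lemma limit_cdf (R : realType) e (h : R -> R) (E : set 'rV[R]_e.+1)
    (w y : 'I_e -> R) (M B : R) (U : set_system nat) N x p del :
  UltraFilter U -> gauge h -> (forall z, E z -> `|z 0 0| < B) ->
  slice_approx h E w y M U N x p del ->
  exists G : R -> R, [/\ {homo G : a b / a <= b},
    forall t, t <= - B -> G t = 0, forall t, B <= t -> G t = 1,
    forall P (l r : nat -> R) (c : R -> nat) (D : nat -> nat -> R) tau, 0 < tau ->
      (forall a, (a < P)%N -> l a <= r a) ->
      (forall s a, `|s| < B -> (a < P)%N -> (c s == a) = (l a < s <= r a)) ->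
      (forall s s', `|s| < B -> `|s'| < B -> (c s < P)%N -> (c s' < P)%N ->
        enorm (dirv w) * `|s - s'| + tau <= D (c s) (c s')) ->
      \sum_(a < P) \sum_(b < P)
        (G (r a) - G (l a)) * (G (r b) - G (l b)) * (h (D a b))^-1 <= M &
    forall a b, a <= b ->
      (\forall n \near U, forall i, (i < N n)%N -> p n i != 0 ->
        ~ (a < x n i 0 0 <= b)) -> G b = G a].
Proof.
move=> UU gh EB [xE p0 p1 xl del0 dels en].
have cdf_bnd t n : `|cdf N x p n t| <= 1.
  rewrite ger0_norm ?sumr_ge0// -(p1 n) [leRHS](bigID (fun i : 'I_(N n) => x n i 0 0 <= t))/=.
  by rewrite lerDl sumr_ge0.
(* The ultrafilter gives a limit at every [t] at once, hence [G] without any extension from a dense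
   set. *)
have /choice[G GP] t : exists l : R, (fun n => cdf N x p n t) @ U --> l.
  exact: ultra_cvg (cdf_bnd t).
have cdf_mono n a b : a <= b -> cdf N x p n a <= cdf N x p n b.
  by move=> ab; rewrite -subr_ge0 cdf_sub// sumr_ge0.
have xB n i : (i < N n)%N -> `|x n i 0 0| < B by move=> iN; apply: EB; exact: xE.
exists G; split.
- move=> a b ab; apply: (ler_cvg_to (GP a) (GP b)).
  by apply: (@filterE _ U) => n; exact: cdf_mono.
- move=> t tB; apply: (cvg_unique _ (GP t)) => //.
  rewrite (_ : cdf N x p ^~ t = fun=> 0); first exact: cvg_cst.
  apply/funext => n; apply: big1 => i /le_trans/(_ tB).
  by have := xB n i (ltn_ord i); rewrite ltr_norml => /andP[] /lt_le_trans H _ /H; rewrite ltxx.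
- move=> t tB; apply: (cvg_unique _ (GP t)) => //.
  rewrite (_ : cdf N x p ^~ t = fun=> 1); first exact: cvg_cst.
  apply/funext => n; rewrite -[RHS](p1 n); apply: eq_bigl => i.
  apply: le_trans tB; have := xB n i (ltn_ord i).
  by rewrite ltr_norml => /andP[_ /ltW].
- move=> P l r c D tau tau0 lr cP DP.
  pose G' n t := cdf N x p n t.
  have cv : (fun n => \sum_(a < P) \sum_(b < P)
      (G' n (r a) - G' n (l a)) * (G' n (r b) - G' n (l b)) * (h (D a b))^-1) @ U -->
    \sum_(a < P) \sum_(b < P)
      (G (r a) - G (l a)) * (G (r b) - G (l b)) * (h (D a b))^-1.
    apply: cvg_sumr => a; apply: cvg_sumr => b.
    apply: cvgMr_tmp; apply: cvgM; apply: cvgB; exact: GP.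
  apply: (cvgr_to_le cv).
  (* One half of [tau] absorbs the distance of the atoms to the line, the other half absorbs
     [del n]. *)
  pose eta := tau / (2 * (2 * e%:R + 1)).
  have e1 : 0 < 2 * e%:R + 1 :> R by rewrite ltr_wpDl// mulr_ge0.
  have eta0 : 0 < eta by rewrite divr_gt0// mulr_gt0.
  have tau20 : 0 < tau / 2 by rewrite divr_gt0.
  near=> n; apply: le_trans (en n).
  have small i j : (i < N n)%N -> (j < N n)%N -> p n i != 0 -> p n j != 0 ->
      enorm (x n i - x n j) + del n <= enorm (dirv w) * `|x n i 0 0 - x n j 0 0| + tau.
    move=> iN jN pi pj.
    have xln : forall i, (i < N n)%N -> p n i != 0 -> forall k,
      `|x n i 0 (lift ord0 k) - w k * x n i 0 0 - y k| <= eta by near: n; exact: xl.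
    have := enorm_near_line (xln _ iN pi) (xln _ jN pj).
    have : del n <= tau / 2 by near: n; exact: dels.
    have : 2 * e%:R * eta <= tau / 2.
      have -> : 2 * e%:R * eta = tau / 2 * (2 * e%:R / (2 * e%:R + 1)).
        by rewrite /eta; field; rewrite gt_eqF.
      rewrite ler_piMr ?(ltW tau20)// ler_pdivrMr// mul1r lerDl//.
    lra.
  have mass a : (a < P)%N -> G' n (r a) - G' n (l a) =
      \sum_(i < N n) (c (x n i 0 0) == a)%:R * p n i.
    move=> aP; rewrite cdf_sub ?lr// big_mkcond/=; apply: eq_bigr => i _.
    by rewrite (cP _ _ (xB _ _ (ltn_ord i)) aP); case: ifP; rewrite ?mul1r ?mul0r.
  (* The sums over cells and over atoms are exchanged. A pair of atoms lies in at most one pair of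
     cells, and there [D] dominates its regularised distance. *)
  under eq_bigr => a _ do under eq_bigr => b _ do
    rewrite (mass a)// (mass b)// big_distrlr/= mulr_suml.
  under eq_bigr => a _ do under eq_bigr => b _ do
    under eq_bigr => i _ do rewrite mulr_suml.
  under eq_bigr => a _ do rewrite exchange_big/=.
  rewrite exchange_big/=; apply: ler_sum => i _.
  under eq_bigr => a _ do rewrite exchange_big/=.
  rewrite exchange_big/=; apply: ler_sum => j _.
  have hpos z : 0 <= z -> 0 < h (z + del n).
    by move=> z0; apply: gauge_gt0 => //; rewrite ltr_wpDl.
  have rhs0 : 0 <= p n i * p n j / h (enorm (x n i - x n j) + del n).
    by rewrite divr_ge0 ?mulr_ge0// ltW// hpos// enorm_ge0.
  have [ciP|ciP] := ltnP (c (x n i 0 0)) P; last first.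
    rewrite big1// => a _; rewrite big1// => b _.
    by rewrite (gtn_eqF (leq_trans (ltn_ord a) ciP)) !mul0r.
  have [cjP|cjP] := ltnP (c (x n j 0 0)) P; last first.
    rewrite big1// => a _; rewrite big1// => b _.
    by rewrite (gtn_eqF (leq_trans (ltn_ord b) cjP)) mul0r mulr0 mul0r.
  rewrite (bigD1 (Ordinal ciP))//= [X in _ + X]big1 ?addr0; last first.
    move=> a ac; rewrite big1// => b _.
    rewrite (_ : c (x n i 0 0) == a = false) ?mul0r//.
    by apply: contraNF ac => /eqP ca; apply/eqP/val_inj.
  rewrite (bigD1 (Ordinal cjP))//= [X in _ + X]big1 ?addr0; last first.
    move=> b bc; rewrite (_ : c (x n j 0 0) == b = false) ?mul0r ?mulr0 ?mul0r//.
    by apply: contraNF bc => /eqP cb; apply/eqP/val_inj.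
  rewrite !eqxx !mul1r.
  have [->|pi] := eqVneq (p n i) 0; first by rewrite !mul0r.
  have [->|pj] := eqVneq (p n j) 0; first by rewrite mulr0 !mul0r.
  apply: ler_wpM2l; first by rewrite mulr_ge0.
  have le1 := small _ _ (ltn_ord i) (ltn_ord j) pi pj.
  have le2 := DP _ _ (xB _ _ (ltn_ord i)) (xB _ _ (ltn_ord j)) ciP cjP.
  have le3 := le_trans le1 le2.
  have pos : 0 < enorm (x n i - x n j) + del n by rewrite ltr_wpDl ?enorm_ge0.
  rewrite lef_pV2 ?posrE ?(gauge_gt0 gh)//; last exact: lt_le_trans le3.
  exact: (gauge_mono gh).
- move=> a b ab H; apply/eqP; rewrite -subr_eq0; apply/eqP.
  have cv : (fun n => cdf N x p n b - cdf N x p n a) @ U --> G b - G a.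
    by apply: cvgB; exact: GP.
  apply: (cvg_unique _ cv) => //; apply: cvg_near_cst.
  near=> n; rewrite cdf_sub//; apply: big1 => i abi.
  have Hn : forall i, (i < N n)%N -> p n i != 0 -> ~ (a < x n i 0 0 <= b) by near: n.
  by apply/eqP/negPn/negP => /(Hn _ (ltn_ord i)); exact.
Unshelve. all: by end_near. Qed.

(** * Monotone convergence from below and measures carried by a line *)

(** Setting [g n] to [+oo] on the null set [bad] leaves its integral unchanged and makes the
    supremum dominate [f] everywhere; monotone convergence then concerns only the measurable
    [g n]. *)
Lemma integral_le_sup_ae (R : realType) dd (T : measurableType dd)
    (mu : {measure set T -> \bar R}) (f : T -> \bar R) (g : nat -> T -> \bar R)
    (bad : set T) (c : \bar R) :
  measurable bad -> mu bad = 0%E -> (forall x, 0 <= f x)%E ->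
  (forall n, measurable_fun setT (g n)) -> (forall n x, 0 <= g n x)%E ->
  (forall x, nondecreasing_seq (g ^~ x)) ->
  (forall x, ~ bad x -> (f x <= ereal_sup (range (g ^~ x)))%E) ->
  (forall n, \int[mu]_x g n x <= c)%E -> (\int[mu]_x f x <= c)%E.
Proof.
move=> mb b0 f0 mg g0 ndg fg gc.
pose g' n x := if x \in bad then +oo%E else g n x.
have mg' n : measurable_fun setT (g' n).
  apply: measurable_fun_ifT => //.
  by apply: (measurable_fun_bool true); rewrite setTI preimage_mem_true.
have g'0 n x : (0 <= g' n x)%E by rewrite /g'; case: ifP.
have ndg' x : nondecreasing_seq (g' ^~ x).
  by move=> m n mn; rewrite /g'; case: ifP => // _; exact: ndg.
have fg' x : (f x <= limn (g' ^~ x))%E.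
  rewrite (cvg_lim _ (ereal_nondecreasing_cvgn (ndg' x)))//.
  have [xb|xb] := pselect (bad x).
    by rewrite (le_trans (leey _))//; apply: ereal_sup_ubound; exists 0%N; rewrite // /g' mem_set.
  apply: le_trans (fg x xb) _; apply: ge_ereal_sup => _ [n _ <-].
  by apply: ereal_sup_ubound; exists n; rewrite // /g' memNset.
apply: le_trans (ge0_le_integral_nomeas mu f0 fg') _.
rewrite monotone_convergence//.
apply: lime_le.
  apply: ereal_nondecreasing_is_cvgn => m n mn.
  by apply: ge0_le_integral_nomeas => // x; exact: ndg'.
apply: nearW => n; apply: le_trans (gc n).
rewrite le_eqVlt; apply/orP; left; apply/eqP/ge0_ae_eq_integral => //.
exists bad; split => // x /= H; apply: contrapT => xb; apply: H => _.
by rewrite /g' memNset.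
Qed.

(** The Lebesgue-Stieltjes measure of [G], pushed forward by the parametrisation [gam] of the line
    by its first coordinate. *)
Lemma line_measure (R : realType) e (w y : 'I_e -> R) (G : R -> R) (B : R) :
  {homo G : a b / a <= b} ->
  (forall t, G x @[x --> t^'+] --> G t) ->
  (forall t, t <= - B -> G t = 0) -> (forall t, B <= t -> G t = 1) ->
  exists nu : {measure set (borelv R e.+1) -> \bar R},
    [/\ nu setT = 1%E, nu (~` graph_line w y) = 0%E &
     forall a b, a <= b ->
       nu [set z : 'rV[R]_e.+1 | a < z 0 0 <= b] = (G b - G a)%:E].
Proof.
move=> Gnd Grc G0 G1.
have Gny : G x @[x --> -oo] --> (0 : R).
  apply: cvg_near_cst; near=> t; apply: G0.
  by near: t; apply: nbhs_ninfty_le; exact: num_real.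
have Gy : G x @[x --> +oo] --> (1 : R).
  apply: cvg_near_cst; near=> t; apply: G1.
  by near: t; apply: nbhs_pinfty_ge; exact: num_real.
pose H1 := isCumulative.Build R _ R G Gnd Grc.
pose H2 := isCumulativeBounded.Build R 0 1 G Gny Gy.
pose Gc : cumulativeBounded (0:R) (1:R) := HB.pack G H1 H2.
pose gam (s : measurableTypeR R) : borelv R e.+1 :=
  \row_i (if unlift ord0 i is Some k then w k * s + y k else s).
have gam_cont : continuous (gam : R -> 'rV[R]_e.+1).
  move=> s; apply/cvg_ballP => eps eps0.
  pose c := 1 + \sum_k `|w k|.
  have c0 : 0 < c by rewrite ltr_pwDl// sumr_ge0.
  near=> t; split => // i j; rewrite !mxE; case: unliftP => [k _|_].
    rewrite /ball/= opprD addrACA subrr addr0 -mulrBr normrM.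
    apply: (@le_lt_trans _ _ (c * `|s - t|)).
      rewrite ler_wpM2r// /c (bigD1 k)//= addrCA lerDl addr_ge0// sumr_ge0//.
    rewrite mulrC -ltr_pdivlMr//; near: t.
    by apply: cvgr_dist_lt; rewrite ?divr_gt0//; exact: cvg_id.
  rewrite /ball/=; near: t; apply: cvgr_dist_lt => //; exact: cvg_id.
have mgam : measurable_fun setT gam.
  have := @measurability _ _ (measurableTypeR R) (borelv R e.+1) setT gam
    (@open 'rV[R]_e.+1 : set (set (borelv R e.+1))).
  apply => // _ [V oV <-]; rewrite setTI.
  apply: open_measurable; apply: open_comp => // s _; exact: gam_cont.
pose nu := measure_function_pushforward__canonical__measure_function_Measure
  (lebesgue_stieltjes_measure Gc) mgam.
exists nu; split.
- by rewrite /nu/= /pushforward preimage_setT; exact: probability_setT.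
- rewrite /nu/= /pushforward (_ : _ @^-1` _ = set0) ?measure0//.
  apply/seteqP; split => // s /=; apply => k; rewrite !mxE.
  by rewrite unlift_none liftK.
- move=> a b ab; rewrite /nu/= /pushforward.
  rewrite (_ : _ @^-1` _ = `]a, b]%classic); last first.
    by apply/seteqP; split => s /=; rewrite in_itv/= !mxE unlift_none.
  rewrite /lebesgue_stieltjes_measure /measure_extension measurable_mu_extE/=; last exact: is_ocitv.
  by rewrite wlength_itv_bnd.
Unshelve. all: by end_near. Qed.

(** * Dyadic cells of the first coordinate *)

(** Cells are counted downwards from [B]: truncation then yields intervals open on the left and
    closed on the right, whose masses are increments of a distribution function. *)
Definition dyadic_index (R : realType) (B : R) m (s : R) : nat :=
  Num.truncn (2 ^+ m * (B - s)).

Lemma dyadic_indexE (R : realType) (B : R) m s a : s <= B ->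
  (dyadic_index B m s == a) = (B - a.+1%:R / 2 ^+ m < s <= B - a%:R / 2 ^+ m).
Proof.
move=> sB; have m0 : 0 < 2 ^+ m :> R by rewrite exprn_gt0.
rewrite /dyadic_index truncn_eq ?mulr_ge0 ?subr_ge0 ?(ltW m0)//.
rewrite andbC mulrC; congr (_ && _).
  by rewrite -ltr_pdivlMr// ltrBlDr addrC -ltrBlDr.
by rewrite -ler_pdivrMr// lerBrDr addrC -lerBrDr.
Qed.

Lemma dyadic_index_lt (R : realType) (B m : nat) (s : R) :
  - B%:R < s -> s <= B%:R -> (dyadic_index B%:R m s < 2 * B * 2 ^ m)%N.
Proof.
move=> s1 s2; have m0 : 0 < 2 ^+ m :> R by rewrite exprn_gt0.
have := truncn_le (2 ^+ m * (B%:R - s)); rewrite mulr_ge0 ?subr_ge0 ?(ltW m0)// => H.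
rewrite -(ltr_nat R) (le_lt_trans H)// mulnC natrM natrX ltr_pM2l// natrM.
by rewrite mulr_natl mulr2n; lra.
Qed.

Lemma dyadic_index_half (R : realType) (B : R) m s : s <= B ->
  dyadic_index B m s = (dyadic_index B m.+1 s)./2.
Proof.
move=> sB; apply/eqP; rewrite /dyadic_index.
have u0 : 0 <= 2 ^+ m * (B - s) by rewrite mulr_ge0 ?subr_ge0 ?exprn_ge0.
rewrite truncn_eq// exprS -mulrA; set u := _ * _ in u0 *.
have := truncn_itv (mulr_ge0 (ler0n R 2) u0); set k := Num.truncn _ => /andP[k1 k2].
have := odd_double_half k; set q := k./2 => kE.
have kE' : k%:R = (odd k)%:R + 2 * q%:R :> R.
  by rewrite -[in LHS]kE natrD -mul2n natrM.
have : (odd k)%:R <= 1 :> R by case: (odd k).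
have : 0 <= (odd k)%:R :> R by [].
rewrite -!natr1 in k2 *; lra.
Qed.

(* Two points of [graph_line] whose first coordinates lie in the cells [a] and [b]
   are closer than [lam * (|a - b| + 1) / 2 ^ m]; the extra [lam / 2 ^ m] absorbs
   the distance of the atoms to the line. *)
Definition dyadic_dist (R : realType) (lam : R) m (a b : nat) : R :=
  lam * (`|a%:R - b%:R| + 2) / 2 ^+ m.

Lemma dyadic_dist_gt0 (R : realType) (lam : R) m a b :
  0 < lam -> 0 < dyadic_dist lam m a b.
Proof. by move=> l0; rewrite divr_gt0 ?exprn_gt0// mulr_gt0// ltr_wpDl. Qed.

(** Refining the cells decreases the distance bound, so the step kernels increase with [m], as
    monotone convergence requires. *)
Lemma dyadic_dist_half (R : realType) (lam : R) m a b : 0 < lam ->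
  dyadic_dist lam m.+1 a b <= dyadic_dist lam m a./2 b./2.
Proof.
move=> l0; rewrite /dyadic_dist -!mulrA ler_pM2l// exprS invfM mulrA.
rewrite ler_pM2r ?invr_gt0 ?exprn_gt0// ler_pdivrMr//.
have aE : a%:R = (odd a)%:R + 2 * (a./2)%:R :> R.
  by rewrite -[in LHS](odd_double_half a) natrD -mul2n natrM.
have bE : b%:R = (odd b)%:R + 2 * (b./2)%:R :> R.
  by rewrite -[in LHS](odd_double_half b) natrD -mul2n natrM.
have a1 : (odd a)%:R <= 1 :> R by case: (odd a).
have b1 : (odd b)%:R <= 1 :> R by case: (odd b).
have a0 : 0 <= (odd a)%:R :> R by [].
have b0 : 0 <= (odd b)%:R :> R by [].
rewrite aE bE.
set x := _%:R - _%:R; have := ler_norm x; have := ler_norm (- x); rewrite normrN /x => n1 n2.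
suff : `|(odd a)%:R + 2 * a./2%:R - ((odd b)%:R + 2 * b./2%:R)| <= 2 * `|a./2%:R - b./2%:R| + 1 :> R by lra.
rewrite ler_norml; lra.
Qed.

(** The lower bound leaves the margin [lam / 2 ^+ m] that serves as [tau] in [limit_cdf]; the upper
    bound lets the step kernels reach the true kernel. *)
Lemma dyadic_dist_bounds (R : realType) (lam B : R) m s s' : 0 < lam ->
  s <= B -> s' <= B ->
  lam * `|s - s'| + lam / 2 ^+ m <=
    dyadic_dist lam m (dyadic_index B m s) (dyadic_index B m s') <=
  lam * `|s - s'| + 3 * lam / 2 ^+ m.
Proof.
move=> l0 sB s'B; have m0 : 0 < 2 ^+ m :> R by rewrite exprn_gt0.
have u0 t : t <= B -> 0 <= 2 ^+ m * (B - t) by move=> tB; rewrite mulr_ge0 ?subr_ge0 ?(ltW m0).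
rewrite /dyadic_dist /dyadic_index.
have := truncn_itv (u0 _ sB); have := truncn_itv (u0 _ s'B).
set k := Num.truncn _; set k' := Num.truncn _.
rewrite -(natr1 k) -(natr1 k') => /andP[a1 a2] /andP[b1 b2].
have E : 2 ^+ m * `|s - s'| = `|2 ^+ m * (B - s') - 2 ^+ m * (B - s)|.
  rewrite -[in LHS](ger0_norm (ltW m0)) -normrM; congr (`|_|); ring.
move: a1 a2 b1 b2 E; set u := _ * (B - s); set u' := _ * (B - s') => a1 a2 b1 b2 E.
have h1 : 2 ^+ m * `|s - s'| + 1 <= `|k'%:R - k%:R| + 2 :> R.
  rewrite E; have := ler_norm (k'%:R - k%:R : R); have := ler_norm (- (k'%:R - k%:R : R)).
  rewrite normrN => ? ?; suff : `|u' - u| <= `|k'%:R - k%:R| + 1 by lra.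
  rewrite ler_norml; lra.
have h2 : `|k'%:R - k%:R| + 2 <= 2 ^+ m * `|s - s'| + 3 :> R.
  rewrite E; have := ler_norm (u' - u); have := ler_norm (- (u' - u)).
  rewrite normrN => ? ?; suff : `|k'%:R - k%:R| <= `|u' - u| + 1 by lra.
  rewrite ler_norml; lra.
rewrite ler_pdivlMr// ler_pdivrMr// !mulrDl !(divfK (lt0r_neq0 m0)).
rewrite -![lam * _ * _]mulrA ![`|s - s'| * _]mulrC.
apply/andP; split.
  by have := ler_wpM2l (ltW l0) h1; rewrite !mulrDr mulr1; lra.
by have := ler_wpM2l (ltW l0) h2; rewrite !mulrDr; lra.
Qed.

Lemma graph_line_closed (R : realType) e (w y : 'I_e -> R) : closed (graph_line w y).
Proof.
rewrite (_ : graph_line w y = \bigcap_(k in setT)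
    [set x : 'rV[R]_e.+1 | x 0 (lift ord0 k) - w k * x 0 0 = y k]); last first.
  apply/seteqP; split => [x xL k _ /=|x xL k]; first by rewrite xL addrAC subrr add0r.
  by rewrite -(xL k I)/= subrKC.
apply: closed_bigI => k _.
have cf : continuous (fun x : 'rV[R]_e.+1 => x 0 (lift ord0 k) - w k * x 0 0 : R).
  have ck := @coord_continuous R 1 e.+1 0 (lift ord0 k).
  have c0 := @coord_continuous R 1 e.+1 0 0.
  by move=> x; exact: (cvgB (ck x) (cvgMl_tmp (a := w k) (c0 x))).
have := @preimage_closed _ _ _ [set t : R | t = y k] _ (@closed_eq _ _).
by apply => x _; exact: cf.
Qed.

Lemma coord_itv_measurable (R : realType) e (a b : R) :
  measurable ([set z : 'rV[R]_e.+1 | a < z 0 0 <= b] : set (borelv R e.+1)).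
Proof.
have om c : measurable ([set z : 'rV[R]_e.+1 | c < z 0 0] : set (borelv R e.+1)).
  apply: open_measurable_borelv.
  apply: (@open_comp _ _ (fun z : 'rV[R]_e.+1 => z 0 0) [set t | c < t]); last exact: open_gt.
  by move=> x _; exact: coord_continuous.
rewrite (_ : mkset _ = [set z : 'rV[R]_e.+1 | a < z 0 0] `\`
    [set z : 'rV[R]_e.+1 | b < z 0 0]); first exact: measurableD.
apply/seteqP; split => z /=; first by move=> /andP[-> zb]; split => //; rewrite ltNge zb.
by move=> [-> /negP]; rewrite -leNgt.
Qed.

Lemma compact_coord_bounded (R : realType) e (E : set 'rV[R]_e.+1) : compact E ->
  exists2 B : nat, (0 < B)%N & forall z, E z -> `|z 0 0| < B%:R.
Proof.
move=> cE.
have cf : {within E, continuous (fun z : 'rV[R]_e.+1 => z 0 0)}.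
  by apply: continuous_subspaceT => z; exact: coord_continuous.
have [M [_ Mb]] := compact_bounded (continuous_compact cf cE).
exists (Num.bound (M + 1)).+1 => // z Ez.
apply: (@le_lt_trans _ _ (M + 1)); first by apply: Mb; [rewrite ltrDl|exists z].
have [M1|M1] := leP 0 (M + 1).
  by rewrite (lt_trans (archi_boundP M1))// ltr_nat.
by rewrite (lt_le_trans M1).
Qed.

Lemma exists_exp2_small (R : realType) (c del : R) : 0 < c -> 0 < del ->
  exists m, c / 2 ^+ m <= del.
Proof.
move=> c0 d0; exists (Num.bound (c / del)).
rewrite ler_pdivrMr ?exprn_gt0// mulrC -ler_pdivrMr//.
apply: le_trans (ltW (archi_boundP _)) _; first by rewrite divr_ge0 ?ltW.
by rewrite -natrX ler_nat ltnW// ltn_expl.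
Qed.

Definition dyadic_cell (R : realType) e (B : R) m a : set (borelv R e.+1) :=
  [set z : 'rV[R]_e.+1 | B - a.+1%:R / 2 ^+ m < z 0 0 <= B - a%:R / 2 ^+ m].

Lemma dyadic_cellP (R : realType) e (B : R) m a (z : 'rV[R]_e.+1) :
  dyadic_cell B m a z <-> z 0 0 <= B /\ dyadic_index B m (z 0 0) = a.
Proof.
split=> [za|[zB /eqP]]; last by rewrite dyadic_indexE.
have zB : z 0 0 <= B.
  by move: za => /andP[_ /le_trans]; apply; rewrite lerBlDr lerDl divr_ge0.
by split => //; apply/eqP; rewrite dyadic_indexE.
Qed.

Lemma dyadic_cell_slab (R : realType) e (B m a : nat) (z : 'rV[R]_e.+1) :
  (a < 2 * B * 2 ^ m)%N -> dyadic_cell B%:R m a z -> - B%:R < z 0 0 <= B%:R.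
Proof.
move=> aP za; have [zB _] := (dyadic_cellP _ _ _ _).1 za; rewrite zB andbT.
move: za => /andP[+ _]; apply: le_lt_trans.
rewrite lerBrDr addrC -lerBrDr ler_pdivrMr ?exprn_gt0//.
rewrite -(ler_nat R) !natrM natrX in aP.
by have -> : B%:R - - B%:R = 2 * B%:R :> R by ring.
Qed.

Lemma trivIset_dyadic_cell (R : realType) e (B : R) m :
  trivIset setT (@dyadic_cell R e B m).
Proof.
move=> a b _ _ [z [/dyadic_cellP[_ <-] /dyadic_cellP[_ <-]]] //.
Qed.

(** * Energy of the limit measure and capacity of a slice *)

(** Monotone convergence is applied twice, to the step kernels [g m] and to their integrals [Phi m];
    the integral of [Phi m] is the sum over cells bounded by the last hypothesis. *)
Lemma energy_line_le (R : realType) e (h : R -> R) (w y : 'I_e -> R) (M : R)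
    (B : nat) (G : R -> R) (nu : {measure set (borelv R e.+1) -> \bar R}) :
  gauge h -> {homo G : a b / a <= b} -> G (- B%:R) = 0 -> G B%:R = 1 ->
  nu setT = 1%E -> nu (~` graph_line w y) = 0%E ->
  (forall a b, a <= b ->
    nu [set z : 'rV[R]_e.+1 | a < z 0 0 <= b] = (G b - G a)%:E) ->
  (forall m, let l a := B%:R - a.+1%:R / 2 ^+ m in let r a := B%:R - a%:R / 2 ^+ m in
    \sum_(a < 2 * B * 2 ^ m) \sum_(b < 2 * B * 2 ^ m)
      (G (r a) - G (l a)) * (G (r b) - G (l b)) *
      (h (dyadic_dist (enorm (dirv w)) m a b))^-1 <= M) ->
  (energy h nu <= M%:E)%E.
Proof.
move=> gh Gnd GmB GB nu1 nuL nuI Gcell.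
set lam := enorm (dirv w) in Gcell.
have lam0 : 0 < lam by apply: lt_le_trans (enorm_dirv_ge1 w).
pose slab : set (borelv R e.+1) := [set z : 'rV[R]_e.+1 | - B%:R < z 0 0 <= B%:R].
have mslab : measurable slab by exact: coord_itv_measurable.
have mL : measurable (graph_line w y : set (borelv R e.+1)).
  by apply: closed_measurable_borelv; exact: graph_line_closed.
have nuslab : nu (~` slab) = 0%E.
  have s1 : nu slab = 1%E by rewrite nuI ?GmB ?GB ?subr0// -subr_ge0 opprK -natrD.
  have : (nu slab + nu (~` slab) = 1)%E.
    rewrite -measureU ?setUv ?setICr//; exact: measurableC.
  rewrite s1; case: (nu (~` slab)) => [x [x1]| |]//; congr (_%:E).
  by apply: (addrI 1); rewrite x1 addr0.
pose bad : set (borelv R e.+1) := ~` graph_line w y `|` ~` slab.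
have mbad : measurable bad by apply: measurableU; exact: measurableC.
have nubad : nu bad = 0%E by rewrite measureU0//; exact: measurableC.
have goodP z : ~ bad z -> graph_line w y z /\ slab z.
  by move=> /not_orP[/contrapT ? /contrapT].
pose P m := (2 * B * 2 ^ m)%N.
pose D m := @dyadic_cell R e B%:R m.
pose dG m a := G (B%:R - a%:R / 2 ^+ m) - G (B%:R - a.+1%:R / 2 ^+ m).
have mD m a : measurable (D m a) by exact: coord_itv_measurable.
have tD m : trivIset setT (D m) by exact: trivIset_dyadic_cell.
have lr m a : B%:R - a.+1%:R / 2 ^+ m <= B%:R - a%:R / 2 ^+ m :> R.
  by rewrite lerD2l lerN2 ler_pM2r ?invr_gt0 ?exprn_gt0// ler_nat.
have nuD m a : nu (D m a) = (dG m a)%:E by rewrite nuI.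
have dG0 m a : 0 <= dG m a by rewrite subr_ge0 Gnd.
pose kap m a b := (h (dyadic_dist lam m a b))^-1.
have kap0 m a b : 0 <= kap m a b.
  by rewrite invr_ge0 ltW// (gauge_gt0 gh)// dyadic_dist_gt0.
pose idx m (z : 'rV[R]_e.+1) := dyadic_index B%:R m (z 0 0).
have inD m z : slab z -> (idx m z < P m)%N /\ D m (idx m z) z.
  by move=> /andP[z1 z2]; split; [exact: dyadic_index_lt|exact/dyadic_cellP].
have notD m z : ~ slab z -> forall a, (a < P m)%N -> ~ D m a z.
  by move=> sz a aP /(dyadic_cell_slab aP).
pose g m z' z := stepfun (D m) (fun a => kap m a (idx m z')) (P m) z.
have gE m z' z : slab z -> g m z' z = (kap m (idx m z) (idx m z'))%:E.
  by move=> sz; have [iP Dz] := inD m z sz; rewrite /g (stepfunE _ (tD m) iP Dz).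
have g0 m z' z : (0 <= g m z' z)%E by exact: stepfun_ge0.
have mg m z' : measurable_fun setT (g m z') by exact: measurable_stepfun.
have gmono z' z : slab z' -> nondecreasing_seq (g ^~ z' ^~ z).
  move=> /andP[_ z'B]; apply/nondecreasing_seqP => m.
  have [sz|sz] := pselect (slab z); last first.
    by rewrite {1}/g stepfun_out//; exact: notD.
  have /andP[_ zB] := sz.
  rewrite !gE// lee_fin lef_pV2 ?posrE ?(gauge_gt0 gh) ?dyadic_dist_gt0//.
  apply: (gauge_mono gh); first exact: dyadic_dist_gt0.
  rewrite /idx (dyadic_index_half m zB) (dyadic_index_half m z'B).
  exact: dyadic_dist_half.
(* The inner integral of [g m], written as a step function of [z'] so that its measurability is
   evident. *)
pose Phi m z' := stepfun (D m) (fun b => \sum_(a < P m) kap m a b * dG m a) (P m) z'.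
have Phic0 m b : 0 <= \sum_(a < P m) kap m a b * dG m a.
  by apply: sumr_ge0 => a _; rewrite mulr_ge0.
have Phi0 m z' : (0 <= Phi m z')%E by exact: stepfun_ge0.
have mPhi m : measurable_fun setT (Phi m) by exact: measurable_stepfun.
have PhiE m z' : slab z' -> Phi m z' = (\int[nu]_z g m z' z)%E.
  move=> sz'; have [iP Dz] := inD m z' sz'.
  rewrite /Phi (stepfunE _ (tD m) iP Dz) integral_stepfun// -sumEFin.
  by apply: eq_bigr => a _; rewrite nuD EFinM.
have Phimono z' : nondecreasing_seq (Phi ^~ z').
  apply/nondecreasing_seqP => m.
  have [sz'|sz'] := pselect (slab z'); last first.
    by rewrite {1}/Phi stepfun_out//; exact: notD.
  rewrite !PhiE//; apply: ge0_le_integral_nomeas => // z.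
  exact: (gmono z' z sz').
(* By [up], the supremum exceeds every value that 1/h still attains after a slack [del] in the
   distance. On the diagonal such values are arbitrarily large by [gauge_small]; elsewhere
   continuity of [h] concludes. *)
have Kg z z' : ~ bad z -> ~ bad z' ->
    (inv_kernel h z z' <= ereal_sup (range (fun m => g m z' z)))%E.
  move=> /goodP[Lz sz] /goodP[Lz' sz'].
  have /andP[_ zB] := sz; have /andP[_ z'B] := sz'.
  have up (T del : R) : 0 < del ->
      T <= (h (lam * `|z 0 0 - z' 0 0| + del))^-1 ->
      (T%:E <= ereal_sup (range (fun m => g m z' z)))%E.
    move=> del0 Tle; have [m mdel] := exists_exp2_small (mulr_gt0 (ltr0n R 3) lam0) del0.
    apply: ereal_sup_ge; exists (g m z' z); first by exists m.
    rewrite gE// lee_fin (le_trans Tle)//.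
    have /andP[_ Dle] := dyadic_dist_bounds m lam0 zB z'B.
    rewrite lef_pV2 ?posrE ?(gauge_gt0 gh) ?dyadic_dist_gt0//; last first.
      by rewrite ltr_wpDl// mulr_ge0// ltW.
    apply: (gauge_mono gh); first exact: dyadic_dist_gt0.
    by apply: le_trans Dle _; rewrite lerD2l.
  rewrite /inv_kernel; case: eqVneq => [zz'|zz'].
    suff -> : ereal_sup (range (fun m => g m z' z)) = +oo%E by [].
    apply/eqyP => A A0; have A1 : 0 < A^-1 by rewrite invr_gt0.
    have [t t0 ht] := gauge_small gh A1.
    apply: (up A t t0); rewrite zz' subrr normr0 mulr0 add0r.
    by rewrite -[A]invrK lef_pV2 ?posrE// (gauge_gt0 gh).
  have zzE : z - z' = (z 0 0 - z' 0 0) *: dirv w.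
    apply/rowP => i; rewrite !mxE; case: unliftP => [k ->|->]; last by rewrite mulr1.
    by rewrite (Lz k) (Lz' k); ring.
  have tE : enorm (z - z') = lam * `|z 0 0 - z' 0 0| by rewrite zzE enormZ mulrC.
  have t0 : 0 < enorm (z - z') by rewrite enorm_gt0// subr_eq0.
  have ch : (fun s => (h s)^-1) s @[s --> enorm (z - z')] --> (h (enorm (z - z')))^-1.
    by apply: cvgV; [rewrite gt_eqF ?(gauge_gt0 gh)|exact: (gauge_cont gh)].
  apply/lee_addgt0Pr => eps eps0; rewrite -leeBlDr// -EFinB.
  have /cvgrPdist_le/(_ eps eps0)/nbhs_ballP[del /= del0 delP] := ch.
  apply: (up _ (del / 2)); first by rewrite divr_gt0.
  rewrite -tE; have := delP (enorm (z - z') + del / 2).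
  rewrite /ball/= opprD addrA subrr add0r normrN gtr0_norm ?divr_gt0//.
  rewrite ltr_pdivrMr// ltr_pMr// ltr1n => /(_ isT).
  by rewrite ler_norml; lra.
rewrite /energy; apply: (@integral_le_sup_ae _ _ _ nu _ Phi bad) => //.
- by move=> z'; apply: integral_ge0 => z _; exact: inv_kernel_ge0 (gauge_gt0 gh).
- move=> z' bz'; have [Lz' sz'] := goodP z' bz'.
  apply: (@integral_le_sup_ae _ _ _ nu _ (g ^~ z') bad) => //.
  + by move=> z; exact: inv_kernel_ge0 (gauge_gt0 gh).
  + by move=> z; exact: gmono.
  + by move=> z bz; exact: Kg.
  + by move=> m; rewrite -PhiE//; apply: ereal_sup_ubound; exists m.
- move=> m; rewrite integral_stepfun//; under eq_bigr do rewrite nuD -EFinM.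
  rewrite sumEFin lee_fin; apply: le_trans (Gcell m).
  rewrite exchange_big/=; apply: ler_sum => b _; rewrite mulr_suml.
  by apply: ler_sum => a _; rewrite [leRHS]mulrC mulrA.
Qed.

(** The measure with distribution function [G] is a competitor: it lives on the slice and its energy
    is at most [M]. *)
Lemma capacity_slice_ge (R : realType) e (h : R -> R) (E : set 'rV[R]_e.+1)
    (w y : 'I_e -> R) (M : R) (U : set_system nat) N x p del :
  UltraFilter U -> gauge h -> compact E -> 0 < M ->
  slice_approx h E w y M U N x p del ->
  ((M^-1)%:E <= capacity h (E `&` graph_line w y))%E.
Proof.
move=> UU gh cE M0 sa.
have clE : closed E by apply: compact_closed cE; exact: norm_hausdorff.
have [B B0 EB] := compact_coord_bounded cE.
have [G [Gnd G0 G1 Gcell Gflat]] := limit_cdf UU gh EB sa.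
set lam := enorm (dirv w) in Gcell *.
have lam1 : 1 <= lam by exact: enorm_dirv_ge1.
have lam0 : 0 < lam by exact: lt_le_trans lam1.
(* [Gcell] with the single cell [(a, b]], index 1 standing for its complement. Since h(0+) = 0, this
   is a modulus of continuity for [G]. *)
have inc a b : a < b -> (G b - G a) ^+ 2 <= M * h ((lam + 1) * (b - a)).
  move=> ab; have ba0 : 0 < b - a by rewrite subr_gt0.
  have := Gcell 1%N (fun=> a) (fun=> b) (fun s => if a < s <= b then 0%N else 1%N)
    (fun _ _ => (lam + 1) * (b - a)) (b - a) ba0.
  rewrite !big_ord1 ler_pdivrMr -?expr2; last first.
    by apply: gauge_gt0 => //; rewrite mulr_gt0// addr_gt0.
  apply.
  - by move=> *; exact: ltW.
  - by move=> s [|//] _ _; case: ifP.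
  - move=> s s' _ _; case: ifP => // /andP[s1 s2] _; case: ifP => // /andP[s3 s4] _.
    rewrite mulrDl mul1r lerD2r ler_wpM2l ?(ltW lam0)// ler_norml; lra.
have Grc t : G z @[z --> t^'+] --> G t.
  apply/cvgrPdist_lt => eps eps0.
  have e20 : 0 < eps ^+ 2 / (2 * M) by rewrite divr_gt0 ?exprn_gt0 ?mulr_gt0.
  have [t0 t00 ht0] := gauge_small gh e20.
  near=> b.
  have tb : t < b by near: b; exact: nbhs_right_gt.
  have bt : b < t + t0 / (lam + 1).
    by near: b; apply: nbhs_right_lt; rewrite ltrDl divr_gt0// addr_gt0.
  have bt0 : 0 < b - t by rewrite subr_gt0.
  rewrite -(@ltr_pXn2r _ 2) ?nnegrE ?(ltW eps0)// real_normK ?num_real// -sqrrN opprB.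
  apply: le_lt_trans (inc _ _ tb) _.
  apply: (@le_lt_trans _ _ (M * (eps ^+ 2 / (2 * M)))).
    rewrite ler_pM2l//; apply: le_trans ht0; apply: (gauge_mono gh).
      by rewrite mulr_gt0// addr_gt0.
    by rewrite mulrC -ler_pdivlMr ?addr_gt0// lerBlDl ltW.
  have -> : M * (eps ^+ 2 / (2 * M)) = eps ^+ 2 / 2 by field; rewrite gt_eqF.
  by rewrite ltr_pdivrMr// ltr_pMr ?exprn_gt0// ltr1n.
have [nu [nu1 nuL nuI]] := line_measure w y Gnd Grc G0 G1.
have rnu : radon nu by apply: finite_measure_radon; rewrite nu1 ltry.
have cLE : closed (E `&` graph_line w y) by apply: closedI => //; exact: graph_line_closed.
(* Near a point of the line outside [E] there are eventually no weighted atoms, so [G] is flat there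
   and the point has a null neighbourhood. *)
have supp : msupport nu `<=` E `&` graph_line w y.
  move=> z sz; apply: contrapT => zEL.
  have [zL|zL] := pselect (graph_line w y z); last first.
    have := sz (~` graph_line w y) (closed_openC (@graph_line_closed _ _ w y)) zL.
    by rewrite nuL ltxx.
  have zE : ~ E z by move=> Ez; exact: zEL.
  have /nbhs_ballP[eps /= eps0 epsE] : nbhs z (~` E).
    by apply: open_nbhs_nbhs; split => //; exact: closed_openC.
  (* An atom within [eta] of the line whose first coordinate is within [eta] of that of [z] differs
     from [z] by at most [(1 + |w k|) * eta] in coordinate [k], which is less than
     [c * eta = eps]. *)
  pose c := 2 + \sum_k `|w k|.
  have c0 : 0 < c by rewrite ltr_pwDl// sumr_ge0.
  pose eta := eps / c.
  have eta0 : 0 < eta by rewrite divr_gt0.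
  have := sz [set z' : 'rV[R]_e.+1 | `|z' 0 0 - z 0 0| < eta].
  have oV : open [set z' : 'rV[R]_e.+1 | `|z' 0 0 - z 0 0| < eta].
    have cf : continuous (fun z' : 'rV[R]_e.+1 => `|z' 0 0 - z 0 0| : R).
      have c1 := @coord_continuous R 1 e.+1 0 0.
      by move=> z'; exact: (cvg_norm (cvgB (c1 z') (cvg_cst (z 0 0)))).
    have := @open_comp _ _ _ [set t : R | t < eta] _ (@open_lt _ _).
    by apply => z' _; exact: cf.
  move=> /(_ oV); rewrite /= subrr normr0 => /(_ eta0); apply/negP; rewrite -leNgt.
  have ab : z 0 0 - eta <= z 0 0 + eta by lra.
  have Gab : G (z 0 0 + eta) = G (z 0 0 - eta).
    apply: Gflat => //; have := sa_line sa eta0; apply: filterS => n xl i iN pi /andP[s1 s2].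
    apply: (epsE (x n i)); last exact: sa_in sa _ _ iN.
    split => // i0 j; rewrite (ord1 i0); case: (unliftP ord0 j) => [k ->|->]; last first.
      apply: (@le_lt_trans _ _ eta).
        by rewrite ler_norml; lra.
      rewrite /eta ltr_pdivrMr// ltr_pMr// /c.
      by have : 0 <= \sum_k `|w k| by [exact: sumr_ge0]; lra.
    have := xl i iN pi k; rewrite zL => xlk.
    have sk : `|w k * (x n i 0 0 - z 0 0)| <= `|w k| * eta.
      by rewrite normrM ler_wpM2l// ler_norml; lra.
    have wk : `|w k| <= \sum_k `|w k| by rewrite (bigD1 k)//= lerDl sumr_ge0.
    apply: (@le_lt_trans _ _ (eta + `|w k| * eta)).
      move: xlk sk; rewrite !ler_norml; set A := w k * x n i 0 0.
      by rewrite mulrBr -/A; lra.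
    have -> : eps = c * eta by rewrite /eta mulrC divfK// gt_eqF.
    by rewrite -{1}(mul1r eta) -mulrDl ltr_pM2r// /c; lra.
  apply: (@le_trans _ _ (nu [set z' : 'rV[R]_e.+1 |
      z 0 0 - eta < z' 0 0 <= z 0 0 + eta])); last by rewrite nuI// Gab subrr.
  apply: le_measure; rewrite ?inE.
  - exact: open_measurable_borelv.
  - exact: coord_itv_measurable.
  - move=> z' /=; rewrite ltr_norml => /andP[? ?]; apply/andP; split; lra.
have EL0 : E `&` graph_line w y != set0.
  apply/eqP => EL; have := measure_setC_msupport rnu cLE supp.
  by rewrite EL setC0 nu1 => /eqP; rewrite onee_eq0.
rewrite /capacity EL0.
suff enM : (energy h nu <= M%:E)%E.
  apply: ereal_sup_ge; exists (energy h nu)^-1%E; first by exists nu.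
  have -> : (M^-1)%:E = (M%:E)^-1%E by rewrite inver gt_eqF.
  rewrite lee_pV2// inE ?lee_fin ?(ltW M0)//.
  apply: integral_ge0 => z' _; apply: integral_ge0 => z _.
  exact: inv_kernel_ge0 (gauge_gt0 gh).
apply: (energy_line_le gh Gnd (G0 _ (lexx _)) (G1 _ (lexx _)) nu1 nuL nuI) => m.
apply: (Gcell _ _ _ (dyadic_index B%:R m) (dyadic_dist lam m) (lam / 2 ^+ m)).
- by rewrite divr_gt0// exprn_gt0.
- by move=> a _; rewrite lerD2l lerN2 ler_pM2r ?invr_gt0 ?exprn_gt0// ler_nat.
- by move=> s a /ltW; rewrite ler_norml => /andP[_ sB] _; exact: dyadic_indexE.
- move=> s s' /ltW; rewrite ler_norml => /andP[_ sB] /ltW.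
  rewrite ler_norml => /andP[_ s'B] _ _.
  by have /andP[] := dyadic_dist_bounds m lam0 sB s'B.
Unshelve. all: by end_near. Qed.

(** * Counting directions and good classes *)

Lemma card_family_le (R : realType) (aT : finType) (rT : finType)
    (F : aT -> pred rT) (Q : R) :
  (forall a, (#|F a|)%:R <= Q) -> (#|family F|)%:R <= Q ^+ #|aT|.
Proof.
move=> FQ; rewrite card_family; set s := image_mem _ _.
have <- : size s = #|aT| by rewrite size_image.
have : forall k, k \in s -> k%:R <= Q by move=> k /mapP[a _ ->].
elim: s => [//|k s IH] sQ /=.
rewrite natrM exprS ler_pM//; first by apply: sQ; rewrite mem_head.
by apply: IH => l ls; apply: sQ; rewrite in_cons ls orbT.
Qed.

Lemma card_ord_spread (R : realType) N (S : {set 'I_N}) (Q : R) : 0 <= Q ->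
  (forall i j : 'I_N, i \in S -> j \in S -> (j : nat)%:R - (i : nat)%:R <= Q) ->
  (#|S|)%:R <= Q + 1.
Proof.
move=> Q0 SQ; have [->|[i0 i0S]] := set_0Vmem S; first by rewrite cards0 addr_ge0.
have [i iS imin] := arg_minnP (fun i : 'I_N => i : nat) i0S.
pose q := Num.truncn Q; pose f (j : 'I_N) : 'I_q.+1 := inord (j - i).
have fS j : j \in S -> (j - i <= q)%N.
  move=> jS; rewrite truncn_ge_nat// natrB ?imin//; exact: SQ.
have finj : {in S &, injective f}.
  move=> j k jS kS /(congr1 val); rewrite /= !inordK ?ltnS ?fS// => jk.
  by apply: val_inj => /=; rewrite -(subnK (imin _ jS)) jk subnK// imin.
rewrite -(card_in_imset finj); apply: (@le_trans _ _ q.+1%:R).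
  by rewrite ler_nat (leq_trans (max_card _))// card_ord.
by rewrite -natr1 lerD2r /q truncn_le.
Qed.

(** Transversality on a grid: each [w k / N] is confined to an interval of length [2 / (N |u_0|)],
    and the existence of a single such direction forces [|u_0|] to be comparable with the norm of
    [u]. *)
Lemma count_directions (R : realType) e N (u : 'rV[R]_e.+1) (t : R) :
  (0 < N)%N -> 0 < t -> t <= enorm u + N%:R^-1 -> `|u 0 0| <= 1 ->
  (#|[pred w : {ffun 'I_e -> 'I_N} | [forall k,
      `|u 0 (lift ord0 k) - u 0 0 * ((w k : nat)%:R / N%:R)| <= N%:R^-1]]|)%:R
    <= (6 * e.+1%:R / t) ^+ e.
Proof.
move=> N0 t0 tu u1; have NR : 0 < N%:R :> R by rewrite ltr0n.
set A := [pred w | _].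
have d0 : 0 < e.+1%:R :> R by [].
(* At separations of the order of the grid step the trivial count [N ^ e] is enough. *)
have [tN|tN] := leP t (4 * e.+1%:R / N%:R).
  apply: (@le_trans _ _ (N%:R ^+ e)).
    rewrite -natrX ler_nat; apply: leq_trans (max_card _) _.
    by rewrite card_ffun !card_ord.
  rewrite lerXn2r ?nnegrE ?divr_ge0 ?mulr_ge0 ?(ltW t0)//.
  rewrite ler_pdivlMr// mulrC -ler_pdivlMr//; apply: le_trans tN _.
  by rewrite ler_pM2r ?invr_gt0// ler_pM2r// ler_nat.
have [w wA|A0] := pickP A; last first.
  by rewrite (eq_card0 A0) exprn_ge0// divr_ge0 ?mulr_ge0 ?(ltW t0).
have tN' : e.+1%:R * N%:R^-1 < t / 4.
  by rewrite ltr_pdivlMr// mulrC mulrA.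
(* The slopes lie in [0, 1], so every other coordinate of [u] is at most [|u_0| + 1/N]. *)
have u0t : t <= 2 * e.+1%:R * `|u 0 0|.
  have : enorm u <= e.+1%:R * `|u 0 0| + e%:R * N%:R^-1.
    apply: le_trans (ler_enorm_sum u) _.
    have -> : e.+1%:R * `|u 0 0| + e%:R * N%:R^-1 =
        `|u 0 0| + e%:R * (`|u 0 0| + N%:R^-1) by rewrite -natr1; ring.
    rewrite big_ord_recl lerD2l.
    apply: (@le_trans _ _ (\sum_(k < e) (`|u 0 0| + N%:R^-1))); last first.
      by rewrite sumr_const card_ord mulr_natl.
    apply: ler_sum => k _.
    have wk1 : (w k : nat)%:R / N%:R <= 1 :> R.
      by rewrite ler_pdivrMr// mul1r ler_nat ltnW.
    have wk0 : 0 <= (w k : nat)%:R / N%:R :> R by rewrite divr_ge0.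
    have /forallP/(_ k) H := wA.
    rewrite -[u 0 (lift ord0 k)](subrK (u 0 0 * ((w k : nat)%:R / N%:R))).
    apply: le_trans (ler_normD _ _) _; rewrite addrC lerD//.
    by rewrite normrM [X in _ * X]ger0_norm// ler_piMr.
  have : e%:R * N%:R^-1 + N%:R^-1 = e.+1%:R * N%:R^-1 :> R.
    by rewrite -[e.+1%:R]natr1 mulrDl mul1r.
  lra.
have u00 : 0 < `|u 0 0|.
  by rewrite -(pmulr_rgt0 _ (mulr_gt0 (ltr0n R 2) d0)) (lt_le_trans t0).
pose F (k : 'I_e) : pred 'I_N := [pred j : 'I_N |
  `|u 0 (lift ord0 k) - u 0 0 * ((j : nat)%:R / N%:R)| <= N%:R^-1].
apply: (@le_trans _ _ (#|family F|)%:R).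
  rewrite ler_nat; apply: subset_leq_card; apply/fintype.subsetP => v /forallP vA.
  by apply/familyP => k; exact: vA.
rewrite -[X in _ ^+ X]card_ord; apply: card_family_le => k.
(* As [|u_0| <= 1], the extra 1 is absorbed in [3 / |u_0|]; with [u0t] this gives the constant 6 = 3
   * 2. *)
apply: (@le_trans _ _ (2 / `|u 0 0| + 1)).
  have := @card_ord_spread R N [set j | F k j] (2 / `|u 0 0|); rewrite cardsE; apply.
    by rewrite divr_ge0.
  move=> i j; rewrite !inE => Fi Fj; rewrite ler_pdivlMr//.
  apply: le_trans (ler_norm _) _; rewrite normrM normr_id.
  have E : u 0 0 * (((j : nat)%:R - (i : nat)%:R) / N%:R) =
    (u 0 (lift ord0 k) - u 0 0 * ((i : nat)%:R / N%:R)) -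
    (u 0 (lift ord0 k) - u 0 0 * ((j : nat)%:R / N%:R)) by ring.
  have : `|u 0 0 * (((j : nat)%:R - (i : nat)%:R) / N%:R)| <= 2 * N%:R^-1.
    rewrite E; apply: le_trans (ler_normB _ _) _.
    have -> : 2 * N%:R^-1 = N%:R^-1 + N%:R^-1 :> R by ring.
    exact: lerD.
  rewrite !normrM (gtr0_norm (_ : 0 < N%:R^-1)) ?invr_gt0// mulrA ler_pM2r ?invr_gt0//.
  by rewrite mulrC.
rewrite -(ler_pM2r t0) divfK ?gt_eqF//.
apply: (@le_trans _ _ (3 / `|u 0 0| * t)).
  rewrite ler_pM2r// -[X in _ + X <= _](divff (lt0r_neq0 u00)) -mulrDl ler_pM2r ?invr_gt0//.
  lra.
rewrite mulrAC ler_pdivrMr//; lra.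
Qed.

(* Both halves use [m <= lam / 2 + m ^ 2 / (2 lam)] in place of Cauchy-Schwarz,
   with [lam = 1 / (2 #|I|)] on the bad classes and [lam = 2 H S] on the good ones. *)
Lemma card_good_classes (R : realType) (I : finType) (m q : I -> R) (H S T : R) :
  (forall b, 0 <= m b) -> \sum_b m b = 1 -> (forall b, 0 <= q b) ->
  (forall b, m b ^+ 2 <= H * q b) -> \sum_b q b <= S ->
  0 < H -> 0 < S -> 4 * (#|I|)%:R * S <= T ->
  1 <= 4 * (#|[pred b | (0 < m b) && (q b <= T * m b ^+ 2)]|)%:R * (H * S).
Proof.
move=> m0 m1 q0 mq qS H0 S0 TS.
set g := [pred b | _].
have I0 : 0 < (#|I|)%:R :> R.
  rewrite ltr0n lt0n; apply: contra_eqN m1 => /eqP I0.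
  rewrite big1 1?eq_sym ?oner_eq0// => b _.
  by have := max_card (pred1 b); rewrite card1 I0.
have T0 : 0 < T by apply: lt_le_trans TS; rewrite !mulr_gt0.
have amgm (lam : R) b : 0 < lam -> m b <= lam / 2 + m b ^+ 2 / (2 * lam).
  move=> l0; rewrite -subr_ge0.
  have -> : lam / 2 + m b ^+ 2 / (2 * lam) - m b = (lam - m b) ^+ 2 / (2 * lam).
    by field; rewrite gt_eqF.
  by rewrite divr_ge0 ?sqr_ge0// mulr_ge0// ltW.
have qle (A : pred I) : \sum_(b | A b) q b <= S.
  by apply: le_trans qS; rewrite [leRHS](bigID A)/= lerDl sumr_ge0.
(* Both terms of the bound contribute at most 1/4; for the second one this is the hypothesis on
   [T]. *)
have badle : \sum_(b | ~~ g b) m b <= 1 / 2.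
  pose lam : R := (2 * (#|I|)%:R)^-1.
  have l0 : 0 < lam by rewrite invr_gt0 mulr_gt0.
  apply: (@le_trans _ _ (\sum_(b | ~~ g b) (lam / 2 + (#|I|)%:R / T * q b))).
    apply: ler_sum => b bg; apply: le_trans (amgm _ _ l0) _.
    have mb : m b ^+ 2 <= q b / T.
      move: bg; rewrite /g/= negb_and -leNgt -ltNge => /orP[mb|/ltW mb].
        have -> : m b = 0 by apply/eqP; rewrite eq_le mb m0.
        by rewrite expr0n divr_ge0// ltW.
      by rewrite ler_pdivlMr// mulrC.
    rewrite lerD2l; apply: (@le_trans _ _ ((q b / T) / (2 * lam))).
      by rewrite ler_pM2r// invr_gt0 mulr_gt0.
    by rewrite le_eqVlt; apply/orP; left; apply/eqP; rewrite /lam; field; rewrite !gt_eqF.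
  rewrite big_split/= -[X in _ + X <= _]mulr_sumr.
  apply: (@le_trans _ _ (1 / 4 + 1 / 4)); last lra.
  apply: lerD.
    apply: (@le_trans _ _ (\sum_(b : I) lam / 2)).
      by rewrite [leRHS](bigID g)/= lerDr sumr_ge0// => b _; rewrite divr_ge0// ltW.
    rewrite sumr_const -[X in X <= _]mulr_natl le_eqVlt; apply/orP; left; apply/eqP.
    by rewrite /lam; field; rewrite gt_eqF.
  apply: (@le_trans _ _ ((#|I|)%:R / T * S)).
    by rewrite ler_pM2l ?divr_gt0.
  by rewrite mulrAC ler_pdivrMr//; lra.
have goodge : 1 / 2 <= \sum_(b | g b) m b.
  by move: m1; rewrite (bigID g)/= => m1; move: badle; rewrite -(lerD2l (\sum_(b | g b) m b)) m1; lra.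
pose lam : R := 2 * (H * S).
have l0 : 0 < lam by rewrite !mulr_gt0.
have : \sum_(b | g b) m b <= (#|g|)%:R * (lam / 2) + H * S / (2 * lam).
  apply: (@le_trans _ _ (\sum_(b | g b) (lam / 2 + H / (2 * lam) * q b))).
    apply: ler_sum => b _; apply: le_trans (amgm _ _ l0) _.
    by rewrite lerD2l [leRHS]mulrAC ler_pM2r// invr_gt0 mulr_gt0.
  rewrite big_split/= -[X in _ + X <= _]mulr_sumr sumr_const -[X in X + _ <= _]mulr_natl lerD2l.
  by rewrite [leRHS]mulrAC ler_pM2l ?divr_gt0 ?mulr_gt0.
have -> : H * S / (2 * lam) = 1 / 4 by rewrite /lam; field; rewrite !gt_eqF.
have -> : lam / 2 = H * S by rewrite /lam; field.
move=> H1; rewrite -mulrA; lra.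
Qed.

(** * Good tubes at a fixed scale *)

(** The trace of the line through [z], relative to the centre of the ball. The shift by [2 * r]
    makes it nonnegative on the ball, so that truncation labels the tubes by natural numbers. *)
Definition line_proj (R : realType) e (x0 : 'rV[R]_e.+1) (r : R) (w : 'I_e -> R)
    (z : 'rV[R]_e.+1) (k : 'I_e) : R :=
  (z - x0) 0 (lift ord0 k) - w k * (z - x0) 0 0 + 2 * r.

Lemma line_proj_itv (R : realType) e (x0 : 'rV[R]_e.+1) r w z k :
  eball x0 r z -> 0 <= w k <= 1 -> 0 <= line_proj x0 r w z k <= 4 * r.
Proof.
rewrite /eball/= => zr /andP[w0 w1].
have co i : `|(z - x0) 0 i| <= r by exact: le_trans (ler_coord_enorm _ _) zr.
have := co (lift ord0 k).
have : `|w k * (z - x0) 0 0| <= r.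
  by rewrite normrM (ger0_norm w0) (le_trans _ (co 0))// ler_piMl.
by rewrite /line_proj !ler_norml => /andP[? ?] /andP[? ?]; apply/andP; split; lra.
Qed.

(** Some direction does at least as well as the average: its tubes have total energy at most
    [C / N ^ e]. Then [card_good_classes] is applied to the masses [m] and energies [I] of its
    tubes. *)
Lemma exists_slices (R : realType) e (h F : R -> R) (E : set 'rV[R]_e.+1) x0
    (r J : R) N n (x : nat -> 'rV[R]_e.+1) (p : nat -> R) :
  gauge h -> (forall t, 0 < t -> t <= 2 * r -> F t = t ^+ e * h t) ->
  0 < r -> 2 * r <= 1 -> 0 < J -> (0 < N)%N -> N%:R^-1 <= r -> E `<=` eball x0 r ->
  (forall i, (i < n)%N -> E (x i)) -> (forall i, 0 <= p i) -> \sum_(i < n) p i = 1 ->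
  \sum_(i < n) \sum_(j < n) p i * p j *
    (F (Num.min (enorm (x i - x j) + N%:R^-1) (2 * r)))^-1 <= J ->
  exists (w : 'I_e -> R) (Gd : seq {ffun 'I_e -> nat}) (q : {ffun 'I_e -> nat} -> nat -> R),
  [/\ forall k, 0 <= w k <= 1, uniq Gd,
    1 <= 4 * (size Gd)%:R * (h (2 * r) * ((6 * e.+1%:R) ^+ e * J / N%:R ^+ e)) &
    forall b, b \in Gd -> [/\ forall k, (b k)%:R <= 4 * r * N%:R,
      forall i, 0 <= q b i, \sum_(i < n) q b i = 1,
      forall i, (i < n)%N -> q b i != 0 -> forall k,
        (b k)%:R / N%:R <= line_proj x0 r w (x i) k <= (b k).+1%:R / N%:R &
      \sum_(i < n) \sum_(j < n) q b i * q b j *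
        (h (enorm (x i - x j) + N%:R^-1))^-1 <= 4 * (30 * e.+1%:R * r) ^+ e * J]].
Proof.
move=> gh Fh r0 r1 J0 N0 Nr Er xE p0 p1 en.
have NR : 0 < N%:R :> R by rewrite ltr0n.
have Ni : 0 < N%:R^-1 :> R by rewrite invr_gt0.
pose W := {ffun 'I_e -> 'I_N}.
pose wR (w : W) (k : 'I_e) : R := (w k : nat)%:R / N%:R.
have wR01 w k : 0 <= wR w k <= 1.
  by rewrite divr_ge0//= ler_pdivrMr// mul1r ler_nat ltnW.
pose L := (Num.truncn (4 * r * N%:R)).+1.
pose lab (w : W) i : {ffun 'I_e -> nat} :=
  [ffun k => Num.truncn (line_proj x0 r (wR w) (x i) k * N%:R)].
have prj (w : W) i k : (i < n)%N -> 0 <= line_proj x0 r (wR w) (x i) k <= 4 * r.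
  by move=> ilt; apply: line_proj_itv => //; apply: Er; exact: xE.
have labL w i k : (i < n)%N -> (lab w i k < L)%N.
  move=> ilt; rewrite ffunE ltnS le_truncn// ler_pM2r//.
  by have /andP[] := prj w i k ilt.
have labP w i k : (i < n)%N ->
    (lab w i k)%:R / N%:R <= line_proj x0 r (wR w) (x i) k <= (lab w i k).+1%:R / N%:R.
  move=> ilt; have /andP[l0 _] := prj w i k ilt.
  have := truncn_itv (mulr_ge0 l0 (ltW NR)).
  rewrite ler_pdivrMr// ler_pdivlMr//.
  by rewrite ffunE => /andP[-> /ltW].
clearbody lab.
(* Labels are bounded here so that the classes form a finite type, but natural numbers in the
   conclusion so that their type does not vary with [N]. *)
have [labI labIk] : exists labI : W -> nat -> {ffun 'I_e -> 'I_L},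
    forall w i k, (i < n)%N -> labI w i k = lab w i k :> nat.
  exists (fun w i => [ffun k => inord (lab w i k)]) => w i k ilt.
  by rewrite ffunE inordK// labL.
pose emb (b : {ffun 'I_e -> 'I_L}) : {ffun 'I_e -> nat} := [ffun k => b k : nat].
have labIE w i b : (i < n)%N -> (lab w i == emb b) = (labI w i == b).
  move=> ilt; apply/eqP/eqP => [lb|<-].
    by apply/ffunP => k; apply: val_inj; rewrite /= labIk// lb ffunE.
  by apply/ffunP => k; rewrite [RHS]ffunE labIk.
pose t i j := Num.min (enorm (x i - x j) + N%:R^-1) (2 * r).
have t0 i j : 0 < t i j by rewrite lt_min mulr_gt0// ltr_wpDl// enorm_ge0.
have t2r i j : t i j <= 2 * r by rewrite ge_min lexx orbT.
pose kap i j := (h (t i j))^-1.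
have kap0 i j : 0 < kap i j by rewrite invr_gt0 (gauge_gt0 gh).
pose C := (6 * e.+1%:R) ^+ e * J.
have C0 : 0 < C by rewrite mulr_gt0// exprn_gt0// mulr_gt0.
have Ne0 : 0 < N%:R ^+ e :> R by rewrite exprn_gt0.
pose S (w : W) := \sum_(i < n) \sum_(j < n | labI w i == labI w j) p i * p j * kap i j.
have cnt i j : (i < n)%N -> (j < n)%N ->
    (#|[pred w | labI w i == labI w j]|)%:R <= (6 * e.+1%:R / t i j) ^+ e.
  move=> ilt jlt; apply: le_trans (@count_directions R e N (x i - x j) _ N0 (t0 i j) _ _); last first.
  - have : enorm (x i - x j) <= 2 * r.
      have := ler_enormD (x i - x0) (x0 - x j); rewrite addrA subrK (enormB x0 (x j)).
      have := Er _ (xE i ilt); have := Er _ (xE j jlt); rewrite /eball/=; lra.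
    by have := ler_coord_enorm (x i - x j) 0; lra.
  - by rewrite /t ge_min lexx.
  rewrite ler_nat; apply: subset_leq_card; apply/fintype.subsetP => w.
  rewrite inE => /eqP lij; rewrite inE; apply/forallP => k.
  have lijk : lab w i k = lab w j k.
    by rewrite -!labIk// lij.
  have := labP w i k ilt; have := labP w j k jlt; rewrite lijk.
  have -> : (x i - x j) 0 (lift ord0 k) - (x i - x j) 0 0 * ((w k : nat)%:R / N%:R) =
     line_proj x0 r (wR w) (x i) k - line_proj x0 r (wR w) (x j) k.
    by rewrite /line_proj /wR !mxE; ring.
  have -> : (lab w j k).+1%:R / N%:R = (lab w j k)%:R / N%:R + N%:R^-1 :> R.
    by rewrite -natr1 mulrDl mul1r.
  by move=> /andP[? ?] /andP[? ?]; rewrite ler_norml; apply/andP; split; lra.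
(* Two atoms share a tube for at most [(6 (e + 1) / t) ^ e] directions, and the factor [t ^- e]
   turns 1/h into 1/F. *)
have sumS : \sum_w S w <= C.
  apply: (@le_trans _ _ ((6 * e.+1%:R) ^+ e *
      \sum_(i < n) \sum_(j < n) p i * p j * (F (t i j))^-1)); last first.
    by rewrite ler_pM2l ?exprn_gt0 ?mulr_gt0.
  rewrite /S exchange_big/= mulr_sumr; apply: ler_sum => i _.
  rewrite (exchange_big_dep xpredT)//= mulr_sumr; apply: ler_sum => j _.
  rewrite sumr_const -[X in X <= _]mulr_natr.
  apply: (@le_trans _ _ (p i * p j * kap i j * (6 * e.+1%:R / t i j) ^+ e)).
    by apply: ler_wpM2l; [rewrite !mulr_ge0// ltW|exact: cnt].
  rewrite Fh// /kap expr_div_n invfM le_eqVlt; apply/orP; left; apply/eqP.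
  by set u := (t i j ^+ e)^-1; set v := (h _)^-1; ring.
have [w Sw] : exists w, S w <= C / N%:R ^+ e.
  have [w _ wmin] := Order.TotalTheory.arg_minP S (erefl : xpredT [ffun=> Ordinal N0]).
  exists w; rewrite ler_pdivlMr//; apply: le_trans sumS.
  have -> : S w * N%:R ^+ e = \sum_(v : W) S w.
    by rewrite sumr_const card_ffun !card_ord -[RHS]mulr_natr natrX.
  by apply: ler_sum => v _; exact: wmin.
pose m b := \sum_(i < n | labI w i == b) p i.
pose I b := \sum_(i < n | labI w i == b) \sum_(j < n | labI w j == b) p i * p j * kap i j.
have m0 b : 0 <= m b by exact: sumr_ge0.
have m1 : \sum_b m b = 1.
  by rewrite -p1 (partition_big (fun i : 'I_n => labI w i) xpredT).
have I0 b : 0 <= I b.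
  by apply: sumr_ge0 => i _; apply: sumr_ge0 => j _; rewrite !mulr_ge0// ltW.
have IS : \sum_b I b <= C / N%:R ^+ e.
  apply: le_trans Sw; rewrite /S.
  rewrite [leRHS](partition_big (fun i : 'I_n => labI w i) xpredT)//=.
  apply: ler_sum => b _; apply: ler_sum => i /eqP lib.
  rewrite le_eqVlt; apply/orP; left; apply/eqP.
  by apply: eq_bigl => j; rewrite lib eq_sym.
have h2r : 0 < h (2 * r) by rewrite (gauge_gt0 gh)// mulr_gt0.
(* The capped distance is at most [2 * r], so the kernel is at least [1 / h (2 * r)]. *)
have mI b : m b ^+ 2 <= h (2 * r) * I b.
  rewrite expr2 /m big_distrlr/= mulr_sumr; apply: ler_sum => i _.
  rewrite mulr_sumr; apply: ler_sum => j _.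
  rewrite mulrCA ler_peMr ?mulr_ge0// ler_pdivlMr ?(gauge_gt0 gh)// mul1r.
  exact: (gauge_mono gh).
have S0 : 0 < C / N%:R ^+ e by rewrite divr_gt0.
pose T := 4 * (30 * e.+1%:R * r) ^+ e * J.
(* Since [r * N >= 1], there are at most [5 * r * N] labels per coordinate; hence 30 = 5 * 6. *)
have TS : 4 * (#|{ffun 'I_e -> 'I_L}|)%:R * (C / N%:R ^+ e) <= T.
  have LN : L%:R <= 5 * r * N%:R.
    rewrite /L -natr1.
    have : (Num.truncn (4 * r * N%:R))%:R <= 4 * r * N%:R.
      by rewrite truncn_le !mulr_ge0// ltW.
    have : 1 <= r * N%:R by rewrite -ler_pdivrMr// mul1r.
    lra.
  rewrite card_ffun !card_ord natrX /T /C.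
  have -> : (30 * e.+1%:R * r) ^+ e =
      (5 * r * N%:R) ^+ e * (6 * e.+1%:R) ^+ e / N%:R ^+ e.
    by rewrite -exprMn -expr_div_n; congr (_ ^+ _); field; rewrite gt_eqF.
  set a := (5 * r * N%:R) ^+ e; set b := (6 * _) ^+ e.
  rewrite [leRHS](_ : _ = 4 * a * (b * J / N%:R ^+ e)); last by ring.
  rewrite (ler_pM2r S0) ler_pM2l// lerXn2r ?nnegrE//.
  by rewrite !mulr_ge0// ltW.
have good := card_good_classes m0 m1 I0 mI IS h2r S0 TS.
set g := [pred b | _] in good.
have embI : injective emb.
  by move=> b b' /ffunP bb; apply/ffunP => k; apply: val_inj; have := bb k; rewrite !ffunE.
pose q (b : {ffun 'I_e -> nat}) i :=
  (lab w i == b)%:R * p i / \sum_(i < n | lab w i == b) p i.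
exists (wR w), [seq emb b | b <- enum g], q; split.
- by move=> k; exact: wR01.
- by rewrite map_inj_uniq ?enum_uniq.
- by rewrite size_map -cardE.
- move=> _ /mapP[b + ->]; rewrite mem_enum inE => /andP[mb Ib].
  have mE : \sum_(i < n | lab w i == emb b) p i = m b.
    by apply: eq_bigl => i; rewrite labIE.
  have qE i : (i < n)%N -> q (emb b) i = (labI w i == b)%:R * p i / m b.
    by move=> ilt; rewrite /q mE labIE.
  split.
  + move=> k; rewrite ffunE; have := ltn_ord (b k); rewrite ltnS.
    by rewrite truncn_ge_nat// !mulr_ge0// ltW.
  + by move=> i; rewrite divr_ge0 ?mE// mulr_ge0.
  + under eq_bigr => i _ do rewrite qE//.
    rewrite -mulr_suml (_ : \sum_(i < n) _ = m b) ?divff ?gt_eqF//.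
    by rewrite [RHS]big_mkcond/=; apply: eq_bigr => i _; case: ifP; rewrite ?mul1r ?mul0r.
  + move=> i ilt; rewrite /q; case: (eqVneq (lab w i) (emb b)) => [<- _ k|_].
      exact: labP.
    by rewrite !mul0r eqxx.
  (* Normalising divides the energy by the squared mass; dropping the cap enlarges the argument of
     [h] and so lowers the kernel. *)
  + apply: (@le_trans _ _ (I b / m b ^+ 2)); last by rewrite ler_pdivrMr ?exprn_gt0.
    rewrite /I mulr_suml [leRHS]big_mkcond/=; apply: ler_sum => i _.
    under eq_bigr => j _ do rewrite !qE//.
    case: eqP => _; last by rewrite big1// => j _; rewrite !mul0r.
    rewrite mulr_suml [leRHS]big_mkcond/=; apply: ler_sum => j _.
    case: eqP => _; last by rewrite !mul0r !(mulr0, mul0r).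
    rewrite !mul1r [leRHS]mulrAC.
    have -> : p i / m b * (p j / m b) = p i * p j / m b ^+ 2.
      by field; rewrite gt_eqF.
    apply: ler_wpM2l; first by rewrite divr_ge0 ?mulr_ge0// exprn_ge0.
    rewrite lef_pV2 ?posrE ?(gauge_gt0 gh)//; last by rewrite ltr_wpDl// enorm_ge0.
    by apply: (gauge_mono gh) => //; rewrite /t ge_min lexx.
Qed.

(** * Grid points in cubes *)

(** An interval of half-length [rho] holds at most [2 rho N + 1] grid points, hence at most
    [3 rho N] once [rho N >= 1]. The bound [K] serves only to make the set of labels finite. *)
Lemma count_in_cubes (R : realType) e (Gd : seq {ffun 'I_e -> nat}) (N m K : nat)
    (v : nat -> 'I_e -> R) (rho : nat -> R) :
  uniq Gd -> (0 < N)%N -> (forall b, b \in Gd -> forall k, (b k < K)%N) ->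
  (forall i, (i < m)%N -> N%:R^-1 <= rho i) ->
  (forall b, b \in Gd -> exists2 i, (i < m)%N &
    forall k, `|(b k)%:R / N%:R - v i k| < rho i) ->
  (size Gd)%:R <= \sum_(i < m) (3 * rho i * N%:R) ^+ e.
Proof.
move=> uG N0 bK rhoN cov; have NR : 0 < N%:R :> R by rewrite ltr0n.
pose ins (b : {ffun 'I_e -> nat}) i :=
  [forall k, `|(b k)%:R / N%:R - v i k| < rho i].
have cover : (size Gd <= \sum_(i < m) size [seq b <- Gd | ins b i])%N.
  have {}cov b : b \in Gd -> exists2 i, (i < m)%N & ins b i.
    by move=> /cov[i im bi]; exists i => //; apply/forallP.
  clear uG bK; elim: Gd cov => [//|b s IH] cov /=.
  have [i im bi] := cov b (mem_head _ _).
  have /IH {}IH : forall b', b' \in s -> exists2 i, (i < m)%N & ins b' i.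
    by move=> b' b's; apply: cov; rewrite in_cons b's orbT.
  apply: (@leq_trans (\sum_(j < m) ((j == Ordinal im) + size [seq b0 <- s | ins b0 j]))).
    by rewrite big_split/= (bigD1 (Ordinal im))//= eqxx -addnA add1n ltnS (leq_trans IH)// leq_addl.
  by apply: leq_sum => j _; case: eqP => [->|_] /=; [rewrite bi|case: ifP].
apply: (@le_trans _ _ (\sum_(i < m) (size [seq b <- Gd | ins b i])%:R)).
  by rewrite -natr_sum ler_nat.
apply: ler_sum => i _; set s := [seq b <- Gd | _].
have rho0 : 0 < rho i by apply: lt_le_trans (rhoN i (ltn_ord i)); rewrite invr_gt0.
have [s0|e0] := posnP (size s); first by rewrite s0 exprn_ge0// !mulr_ge0// ltW.
have [K' KE] : exists K', forall b, b \in s -> forall k, (b k < K'.+1)%N.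
  exists K => b; rewrite mem_filter => /andP[_ /bK bK'] k.
  exact: leq_trans (bK' k) (leqnSn K).
pose f (b : {ffun 'I_e -> nat}) : {ffun 'I_e -> 'I_K'.+1} := [ffun k => inord (b k)].
have fE b k : b \in s -> f b k = b k :> nat by move=> bs; rewrite ffunE inordK// KE.
have finj : {in s &, injective f}.
  move=> b b' bs b's fb; apply/ffunP => k.
  by rewrite -(fE b)// -(fE b')// fb.
have us : uniq (map f s) by rewrite map_inj_in_uniq ?filter_uniq.
pose Q : 'I_e -> pred 'I_K'.+1 := fun k =>
  [pred j : 'I_K'.+1 | `|(j : nat)%:R / N%:R - v i k| < rho i].
rewrite -(size_map f) -(card_uniqP us).
apply: (@le_trans _ _ (#|family Q|)%:R).
  rewrite ler_nat; apply: subset_leq_card; apply/fintype.subsetP => _ /mapP[b bs ->].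
  apply/familyP => k; rewrite inE /= fE//.
  by move: bs; rewrite mem_filter => /andP[/forallP].
rewrite -[X in _ ^+ X]card_ord; apply: card_family_le => k.
apply: (@le_trans _ _ (2 * rho i * N%:R + 1)).
  have := @card_ord_spread R _ [set j | Q k j] (2 * rho i * N%:R).
  rewrite cardsE; apply; first by rewrite !mulr_ge0// ltW.
  move=> j j'; rewrite !inE /Q /= !ltr_norml => /andP[j1 _] /andP[_ j2].
  by rewrite -ler_pdivrMr// mulrBl; lra.
have : 1 <= rho i * N%:R by rewrite -ler_pdivrMr// mul1r rhoN.
lra.
Qed.

(** * Behaviour of the gauge at 0 and nearly optimal measures *)

Lemma gauge_of_extension (R : realType) (alpha beta : R) (h : R -> R) :
  0 < alpha -> 0 < beta -> gauge_extension (h_gauge alpha beta) h -> gauge h.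
Proof.
move=> a0 b0 [hE h0 hm hc]; split => // eps eps0.
(* With [t = exp (- exp u)] the double logarithm of [1 / t] is [u], so
   [h t = exp (- beta u) * u ^ (- alpha)]. Taking [u >= 2] ensures [t <= exp (- 3)] and makes the
   second factor at most 1. *)
pose u : R := Num.max 2 (- ln eps / beta).
have u2 : 2 <= u by rewrite /u le_max lexx.
have u0 : 0 < u by apply: lt_le_trans u2.
have ub : - ln eps <= beta * u by rewrite mulrC -ler_pdivrMr// /u le_max lexx orbT.
have s3 : 3 <= expR u by have := expR_ge1Dx u; lra.
exists (expR (- expR u)); first exact: expR_gt0.
rewrite hE; last by rewrite expR_gt0 ler_expR lerN2.
rewrite /h_gauge -expRN opprK expRK expRK.
rewrite /powR !gt_eqF ?expR_gt0// expRK -[eps]lnK ?posrE//.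
apply: (@le_trans _ _ (expR (ln eps) * 1)); last by rewrite mulr1.
apply: ler_pM; rewrite ?expR_ge0//; first by rewrite ler_expR; lra.
by rewrite -expR0 ler_expR mulNr oppr_le0 mulr_ge0 ?(ltW a0)// ln_ge0//; lra.
Qed.

(** Distances in [E] are at most [2 * r], so all energies are at least [1 / F (2 * r)]. The capacity
    is therefore finite, and some competitor exceeds half of it. *)
Lemma half_optimal_measure (R : realType) d (F : R -> R) (E : set 'rV[R]_d) x0 (r : R) :
  (forall t, 0 < t -> 0 < F t) -> (forall s t, 0 < s -> s <= t -> F s <= F t) ->
  compact E -> E `<=` eball x0 r -> 0 < r -> (0 < capacity F E)%E ->
  exists (mu : {measure set (borelv R d) -> \bar R}) (J : R),
  [/\ radon mu, msupport mu `<=` E, mu setT = 1%E, (energy F mu <= J%:E)%E &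
    0 < J /\ (capacity F E <= (2 / J)%:E)%E].
Proof.
move=> F0 Fm cE Er r0; rewrite /capacity; case: ifPn => [_|_]; last by rewrite ltxx.
set S := [set _ | _ in _] => S0.
have r20 : 0 < 2 * r by rewrite mulr_gt0.
have en (mu : {measure set (borelv R d) -> \bar R}) :
    radon mu -> msupport mu `<=` E -> mu setT = 1%E ->
    ((F (2 * r))^-1%:E <= energy F mu)%E.
  move=> rmu smu mu1.
  have en0 : (0 <= energy F mu)%E.
    by apply: integral_ge0 => y _; apply: integral_ge0 => x _; exact: inv_kernel_ge0.
  have [->|enoo] := eqVneq (energy F mu) +oo%E; first exact: leey.
  have enE : energy F mu = (fine (energy F mu))%:E.
    by rewrite fineK// ge0_fin_numE// ltey.
  have le1 : (energy F mu <= (fine (energy F mu))%:E)%E by rewrite -enE.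
  (* Any scale would do: the cap [2 * r] alone bounds the discrete kernel below. *)
  have [n [x [p [_ p0 p1 pJ]]]] :=
    discrete_energy rmu smu mu1 cE Er r0 F0 Fm le1 (ltr01 : 0 < 1).
  rewrite enE lee_fin; apply: le_trans pJ.
  apply: (@le_trans _ _ (\sum_(i < n) \sum_(j < n) p i * p j * (F (2 * r))^-1)).
    under eq_bigr => i _ do rewrite -mulr_suml -mulr_sumr p1 mulr1.
    by rewrite -mulr_suml p1 mul1r.
  apply: ler_sum => i _; apply: ler_sum => j _; apply: ler_wpM2l; first exact: mulr_ge0.
  have t0 : 0 < Num.min (enorm (x i - x j) + 1) (2 * r).
    by rewrite lt_min r20 andbT ltr_wpDl// enorm_ge0.
  by rewrite lef_pV2 ?posrE ?F0// Fm// ge_min lexx orbT.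
have Sfin : (ereal_sup S <= (F (2 * r))%:E)%E.
  apply: ge_ereal_sup => _ [mu [rmu smu mu1] <-].
  rewrite -[(F (2 * r))%:E]inveK inver gt_eqF ?F0// lee_pV2 ?en// inE ?lee_fin ?invr_ge0 ?ltW ?F0//.
  by apply: lt_le_trans (en mu rmu smu mu1); rewrite lte_fin invr_gt0 F0.
have [Cap CapE] : exists Cap : R, ereal_sup S = Cap%:E.
  by exists (fine (ereal_sup S)); rewrite fineK// ge0_fin_numE ?(ltW S0)// (le_lt_trans Sfin)// ltry.
have Cap0 : 0 < Cap by rewrite -lte_fin -CapE.
have : ((Cap / 2)%:E < ereal_sup S)%E.
  by rewrite CapE lte_fin ltr_pdivrMr// ltr_pMr// ltr1n.
move=> /ereal_sup_gt[_ [mu [rmu smu mu1] <-]] muC.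
have enpos := lt_le_trans (_ : (0 < (F (2 * r))^-1%:E)%E) (en mu rmu smu mu1).
have {}enpos : (0 < energy F mu)%E by apply: enpos; rewrite lte_fin invr_gt0 F0.
have enfin : energy F mu != +oo%E.
  apply/eqP => enoo; move: muC; rewrite enoo invey lte_fin ltNge.
  by rewrite divr_ge0// ltW.
have enE : energy F mu = (fine (energy F mu))%:E.
  by rewrite fineK// ge0_fin_numE ?(ltW enpos)// ltey.
move: enpos muC; rewrite enE lte_fin; set J := fine _ => J0.
rewrite inver gt_eqF// lte_fin => CJ.
exists mu, J; split => //; first by rewrite enE.
by split; rewrite // CapE lee_fin; move: CJ; rewrite ltr_pdivrMr// mulrC => /ltW.
Qed.

(** * Limit direction and limit tubes *)

(** [A] consists of the limits along [U] of all selections of one good label [b / N] per scale. The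
    last conclusion stands in for a lower bound on the volume of [A]. *)
Lemma limit_family (R : realType) e (h F : R -> R) (E : set 'rV[R]_e.+1) x0 (r J : R)
    (mu : {measure set (borelv R e.+1) -> \bar R}) :
  gauge h -> (forall t, 0 < t -> 0 < F t) ->
  (forall s t, 0 < s -> s <= t -> F s <= F t) ->
  (forall t, 0 < t -> t <= 2 * r -> F t = t ^+ e * h t) ->
  0 < r -> 2 * r <= 1 -> 0 < J -> compact E -> E `<=` eball x0 r ->
  radon mu -> msupport mu `<=` E -> mu setT = 1%E -> (energy F mu <= J%:E)%E ->
  exists (wl : 'I_e -> R) (A : set ('I_e -> R)), [/\ forall k, 0 <= wl k <= 1,
    forall Y, A Y -> ((4 * (30 * e.+1%:R * r) ^+ e * J)^-1%:E <=
      capacity h (E `&` [set z | forall k, line_proj x0 r wl z k = Y k]))%E &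
    forall (v : nat -> 'I_e -> R) (rho : nat -> R), (forall i, 0 < rho i) ->
      (forall Y, A Y -> exists i, forall k, `|Y k - v i k| < rho i) ->
      exists m, 1 <= 4 * h (2 * r) * ((6 * e.+1%:R) ^+ e * J) *
                     \sum_(i < m) (3 * rho i) ^+ e].
Proof.
move=> gh F0 Fm Fh r0 r1 J0 cE Er rmu smu mu1 en.
have [n0 n0r] : exists n0 : nat, n0.+1%:R^-1 <= r.
  exists (Num.bound r^-1); rewrite invf_ple ?posrE// ltW//.
  by rewrite (lt_trans (archi_boundP _)) ?invr_ge0 ?(ltW r0)// ltr_nat.
(* The shift by [n0] ensures [1 / N <= r] at every scale. *)
pose N n := (n + n0).+1.
have NR n : 0 < (N n)%:R :> R by [].
have Nr n : (N n)%:R^-1 <= r.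
  by apply: le_trans n0r; rewrite lef_pV2 ?posrE// ler_nat ltnS leq_addl.
have Ni n : 0 < (N n)%:R^-1 :> R by rewrite invr_gt0.
have [nn /choice[x /choice[p xp]]] := choice (fun n =>
  discrete_energy rmu smu mu1 cE Er r0 F0 Fm en (Ni n)).
have sl n : exists (w : 'I_e -> R) (Gd : seq {ffun 'I_e -> nat}) 
    (q : {ffun 'I_e -> nat} -> nat -> R), [/\ forall k, 0 <= w k <= 1, uniq Gd,
    1 <= 4 * (size Gd)%:R * (h (2 * r) * ((6 * e.+1%:R) ^+ e * J / (N n)%:R ^+ e)) &
    forall b, b \in Gd -> [/\ forall k, (b k)%:R <= 4 * r * (N n)%:R,
      forall i, 0 <= q b i, \sum_(i < nn n) q b i = 1,
      forall i, (i < nn n)%N -> q b i != 0 -> forall k,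
        (b k)%:R / (N n)%:R <= line_proj x0 r w (x n i) k <= (b k).+1%:R / (N n)%:R &
      \sum_(i < nn n) \sum_(j < nn n) q b i * q b j *
        (h (enorm (x n i - x n j) + (N n)%:R^-1))^-1 <= 4 * (30 * e.+1%:R * r) ^+ e * J]].
  have [xE p0 p1 pJ] := xp n.
  exact: (exists_slices gh Fh r0 r1 J0 (isT : (0 < N n)%N) (Nr n) Er xE p0 p1 pJ).
have [w /choice[Gd /choice[q wGq]]] := choice sl.
have [U [UU ooU]] := @ultraFilterLemma nat \oo eventually_filter.
have w01 n k : 0 <= w n k <= 1 by have [] := wGq n.
have /choice[wl wlP] k : exists l : R, w ^~ k @ U --> l.
  apply: (@ultra_cvg _ _ _ 1) => n; have /andP[? ?] := w01 n k; by rewrite ger0_norm.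
(* With no good tube the counting bound would read [1 <= 0]. *)
have Gd0 n : exists b, b \in Gd n.
  have [_ _ + _] := wGq n; case: (Gd n) => [|b s _].
    by rewrite mulr0 mul0r ler10.
  by exists b; rewrite mem_head.
have NU (eta : R) : 0 < eta -> \forall n \near U, (N n)%:R^-1 <= eta.
  move=> eta0; apply: ooU; exists (Num.bound eta^-1) => // n /= nb.
  rewrite invf_ple ?posrE// (le_trans (ltW (archi_boundP _))) ?invr_ge0 ?(ltW eta0)//.
  by rewrite ler_nat (leq_trans nb)// /N leqW// leq_addr.
pose A : set ('I_e -> R) := [set Y | exists beta : nat -> {ffun 'I_e -> nat},
  (forall n, beta n \in Gd n) /\
  forall k, (fun n => (beta n k)%:R / (N n)%:R) @ U --> Y k].
exists wl, A; split.
- move=> k; apply/andP; split.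
    by apply: (cvgr_to_ge (wlP k)); apply: nearW => n; have /andP[] := w01 n k.
  by apply: (cvgr_to_le (wlP k)); apply: nearW => n; have /andP[] := w01 n k.
- move=> Y [beta [bG bY]].
  pose y k := Y k + x0 0 (lift ord0 k) - wl k * x0 0 0 - 2 * r.
  have -> : [set z | forall k, line_proj x0 r wl z k = Y k] = graph_line wl y.
    by apply/seteqP; split => z zP k; have := zP k; rewrite /line_proj /y !mxE; lra.
  apply: (@capacity_slice_ge _ _ _ _ _ _ _ U nn x
    (fun n i => q n (beta n) i) (fun n => (N n)%:R^-1)) => //.
    by rewrite !mulr_gt0// exprn_gt0// !mulr_gt0.
  split.
  + by move=> n i; have [xE _ _ _] := xp n; exact: xE.
  + by move=> n i; have [_ _ _ /(_ _ (bG n))[]] := wGq n.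
  + by move=> n; have [_ _ _ /(_ _ (bG n))[]] := wGq n.
  (* The three thirds of [eta] are the width of the tube, the error in the direction (on coordinates
     at most 1) and the error in the label. *)
  + move=> eta eta0; have eta30 : 0 < eta / 3 by rewrite divr_gt0.
    near=> n.
    have nN : (N n)%:R^-1 <= eta / 3 by near: n; exact: NU.
    have nw : forall k, `|wl k - w n k| <= eta / 3.
      by near: n; apply: filter_forall => k; exact: cvgr_dist_le (wlP k) _ eta30.
    have nb : forall k, `|Y k - (beta n k)%:R / (N n)%:R| <= eta / 3.
      by near: n; apply: filter_forall => k; exact: cvgr_dist_le (bY k) _ eta30.
    move=> i ilt qi k; have [xE _ _ _] := xp n.
    have [_ _ _ /(_ _ (bG n))[_ _ _ /(_ i ilt qi k) + _]] := wGq n.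
    have xr : `|(x n i - x0) 0 0| <= 1.
      by have := Er _ (xE _ ilt); have := ler_coord_enorm (x n i - x0) 0; rewrite /eball/=; lra.
    have wx : `|(wl k - w n k) * (x n i - x0) 0 0| <= eta / 3.
      by rewrite normrM (le_trans _ (nw k))// ler_piMr.
    rewrite -natr1 mulrDl mul1r /line_proj.
    move: wx (nb k); rewrite /y !mxE !ler_norml.
    move=> /andP[? ?] /andP[? ?] /andP[? ?]; apply/andP; split; lra.
  + by move=> n; exact: Ni.
  + exact: NU.
  + by move=> n; have [_ _ _ /(_ _ (bG n))[]] := wGq n.
- move=> v rho rho0 cov.
  pose ins n (b : {ffun 'I_e -> nat}) i := forall k, `|(b k)%:R / (N n)%:R - v i k| < rho i.
  pose bad n m := exists2 b, b \in Gd n & forall i, (i < m)%N -> ~ ins n b i.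
  (* Otherwise, for each [m], at almost every scale some good label misses the first [m] cubes. A
     label missing the longest possible initial run among the first [n] cubes, chosen at each scale
     [n], has a limit in [A] that no cube contains. *)
  have [m mgood] : exists m, \forall n \near U, ~ bad n m.
    apply: contrapT => H.
    have badU m : \forall n \near U, bad n m.
      have [//|nb] := in_ultra_setVsetC (bad ^~ m) UU.
      by exfalso; apply: H; exists m.
    have sel n M : exists2 b, b \in Gd n &
        forall m, (m <= M)%N -> bad n m -> forall i, (i < m)%N -> ~ ins n b i.
      elim: M => [|M [b bG bM]].
        by have [b bG] := Gd0 n; exists b => // m; rewrite leqn0 => /eqP ->.
      have [[b' b'G b'P]|nb] := pselect (bad n M.+1).
        by exists b' => // m mM _ i im; apply: b'P; exact: leq_trans mM.
      by exists b => // m; rewrite leq_eqVlt => /predU1P[->//|]; rewrite ltnS; exact: bM.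
    have /choice[beta bP] n : exists b, b \in Gd n /\
        forall m, (m <= n)%N -> bad n m -> forall i, (i < m)%N -> ~ ins n b i.
      by have [b ? ?] := sel n n; exists b.
    have bG n : beta n \in Gd n by have [] := bP n.
    have /choice[Y YP] k : exists l : R, (fun n => (beta n k)%:R / (N n)%:R) @ U --> l.
      apply: (@ultra_cvg _ _ _ (4 * r)) => n.
      by rewrite ger0_norm ?divr_ge0// ler_pdivrMr//; have [_ _ _ /(_ _ (bG n))[]] := wGq n.
    have [i iP] : exists i, forall k, `|Y k - v i k| < rho i by apply: cov; exists beta.
    have insU : \forall n \near U, ins n (beta n) i.
      apply: filter_forall => k.
      have cv : (fun n => `|(beta n k)%:R / (N n)%:R - v i k|) @ U --> `|Y k - v i k|.
        by apply: cvg_norm; apply: cvgB; [exact: YP|exact: cvg_cst].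
      exact: cvgr_lt cv _ (iP k).
    have leU : \forall n \near U, (i.+1 <= n)%N by apply: ooU; exists i.+1.
    have [n [[/= n1 n2] n3]] := @filter_ex _ U _ _ (filterI (filterI insU leU) (badU i.+1)).
    by have [_ /(_ _ n2 n3 i (ltnSn i))] := bP n.
  exists m.
  have rhoU : \forall n \near U, forall i : 'I_m, (N n)%:R^-1 <= rho i.
    by apply: filter_forall => i; exact: NU.
  have [n [/= ngood nrho]] := @filter_ex _ U _ _ (filterI mgood rhoU).
  have [_ uG G1 GP] := wGq n.
  have := @count_in_cubes R e (Gd n) (N n) m (Num.truncn (4 * r * (N n)%:R)).+1 v rho uG isT.
  move=> cnt; have {}cnt : (size (Gd n))%:R <= \sum_(i < m) (3 * rho i * (N n)%:R) ^+ e.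
    apply: cnt.
    - move=> b /GP[bk _ _ _ _] k; rewrite ltnS truncn_ge_nat ?bk//.
      by rewrite !mulr_ge0// ltW.
    - by move=> i im; exact: (nrho (Ordinal im)).
    - move=> b bG; apply: contrapT => H; apply: ngood; exists b => // i im insb.
      by apply: H; exists i.
  apply: (le_trans G1); set h2 := h (2 * r).
  have h20 : 0 < h2 by rewrite (gauge_gt0 gh)// mulr_gt0.
  have Ne : 0 < (N n)%:R ^+ e :> R by rewrite exprn_gt0.
  have -> : \sum_(i < m) (3 * rho i) ^+ e =
      (\sum_(i < m) (3 * rho i * (N n)%:R) ^+ e) / (N n)%:R ^+ e.
    by rewrite mulr_suml; apply: eq_bigr => i _; rewrite (exprMn e (3 * rho i)) mulfK// gt_eqF.
  set s := \sum_(i < m) _ in cnt *; set C := (6 * _) ^+ e * J.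
  have C0 : 0 < C by rewrite mulr_gt0// exprn_gt0// mulr_gt0.
  have -> : 4 * h2 * C * (s / (N n)%:R ^+ e) = 4 * s * (h2 * (C / (N n)%:R ^+ e)).
    by ring.
  rewrite ler_pM2r; last by rewrite mulr_gt0// divr_gt0.
  by apply: ler_wpM2l.
Unshelve. all: by end_near. Qed.

(** * Lower bound for the Hausdorff measure *)

Lemma ediam_ge0 (R : realType) d (A : set 'rV[R]_d) : (0 <= ediam A)%E.
Proof. by rewrite /ediam le_max lexx. Qed.

Lemma hausdorff_ge0 (R : realType) d s (A : set 'rV[R]_d) : (0 <= hausdorff s A)%E.
Proof.
apply: (@le_trans _ _ (hausdorff_delta s 1 A)); last first.
  by apply: ereal_sup_ubound; exists 1; rewrite /= ?ltr01.
apply: le_ereal_inf_tmp => _ [U _ <-]; apply: nneseries_ge0 => i _ _.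
by apply: expe_ge0; exact: ediam_ge0.
Qed.

Lemma ler_line_proj (R : realType) e x0 (r : R) (w : 'I_e -> R) (a b : 'rV[R]_e.+1) k :
  0 <= w k <= 1 ->
  `|line_proj x0 r w a k - line_proj x0 r w b k| <= 2 * enorm (a - b).
Proof.
move=> /andP[w0 w1].
have -> : line_proj x0 r w a k - line_proj x0 r w b k =
    (a - b) 0 (lift ord0 k) - w k * (a - b) 0 0.
  by rewrite /line_proj !mxE; ring.
apply: le_trans (ler_normB _ _) _; rewrite mulr_natl mulr2n; apply: lerD.
  exact: ler_coord_enorm.
by rewrite normrM (ger0_norm w0) (le_trans _ (ler_coord_enorm _ 0))// ler_piMl.
Qed.

Lemma exprD_le2 (R : realType) (a b : R) e : 0 <= a -> 0 <= b ->
  (a + b) ^+ e <= 2 ^+ e * (a ^+ e + b ^+ e).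
Proof.
move=> a0 b0; wlog ab : a b a0 b0 / a <= b => [H|].
  by have [|/ltW] := leP a b; [exact: H|rewrite addrC [X in _ * X]addrC; exact: H].
apply: (@le_trans _ _ ((2 * b) ^+ e)).
  by rewrite lerXn2r ?nnegrE ?addr_ge0 ?mulr_ge0//; lra.
by rewrite exprMn ler_pM2l ?exprn_gt0// lerDr exprn_ge0.
Qed.

(* The cubes have half-side [2 diam (U i) + eta i]: [line_proj] is 2-Lipschitz, and
   the summable [eta i] makes the cubes open and nondegenerate. *)
Lemma hausdorff_ge_of_cubes (R : realType) e x0 (r : R) (w : 'I_e -> R)
    (A : set ('I_e -> R)) (G : set 'rV[R]_e.+1) (K : R) :
  (0 < e)%N -> 0 < K -> (forall k, 0 <= w k <= 1) ->
  (forall Y, A Y -> exists2 a, G a & forall k, line_proj x0 r w a k = Y k) ->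
  (forall (v : nat -> 'I_e -> R) (rho : nat -> R), (forall i, 0 < rho i) ->
    (forall Y, A Y -> exists i, forall k, `|Y k - v i k| < rho i) ->
    exists m, 1 <= K * \sum_(i < m) (3 * rho i) ^+ e) ->
  (((K * 12 ^+ e)^-1)%:E <= hausdorff e G)%E.
Proof.
move=> e0 K0 w01 AG cubes.
apply: (@le_trans _ _ (hausdorff_delta e 1 G)); last first.
  by apply: ereal_sup_ubound; exists 1; rewrite /= ?ltr01.
apply: le_ereal_inf_tmp => _ [U [GU dU] <-].
pose dm i := fine (ediam (U i)).
have dmE i : ediam (U i) = (dm i)%:E.
  by rewrite fineK// ge0_fin_numE ?ediam_ge0// (le_lt_trans (dU i))// ltry.
have dm0 i : 0 <= dm i by rewrite -lee_fin -dmE ediam_ge0.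
have dmP i a b : U i a -> U i b -> enorm (a - b) <= dm i.
  move=> Ua Ub; rewrite -lee_fin -dmE /ediam le_max; apply/orP; right.
  by apply: ereal_sup_ubound; exists (a, b).
(* Centre of the cube that replaces [U i]; the default 0 for an empty [U i] only adds a harmless
   cube. *)
have /choice[pt ptP] i : exists a, U i !=set0 -> U i a.
  by have [[a Ua]|H] := pselect (U i !=set0); [exists a|exists 0].
pose v i := line_proj x0 r w (pt i).
suff H (tau : R) : 0 < tau -> tau <= 1 ->
    (((K^-1 - tau) / 12 ^+ e)%:E <= \sum_(0 <= i <oo) ediam (U i) ^+ e)%E.
  apply/lee_addgt0Pr => eps eps0.
  pose tau := Num.min 1 eps.
  have tau0 : 0 < tau by rewrite lt_min ltr01.
  apply: le_trans (leeD2r _ (H tau tau0 _)); last by rewrite ge_min lexx.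
  rewrite -EFinD lee_fin mulrBl invfM -addrA lerDl addrC subr_ge0.
  rewrite ler_pdivrMr ?exprn_gt0//.
  apply: (@le_trans _ _ (eps * 1)); first by rewrite mulr1 /tau ge_min lexx orbT.
  by rewrite ler_pM2l// exprn_ege1// ler1n.
move=> tau0 tau1.
pose eta i := tau / (2 ^ i.+1)%:R / 6.
have p2 i : 0 < (2 ^ i.+1)%:R :> R by rewrite ltr0n expn_gt0.
have eta0 i : 0 < eta i by rewrite !divr_gt0.
pose rho i := 2 * dm i + eta i.
have rho0 i : 0 < rho i by rewrite ltr_wpDl// mulr_ge0.
have [m mP] : exists m, 1 <= K * \sum_(i < m) (3 * rho i) ^+ e.
  apply: (cubes v rho rho0) => Y AY; have [a Ga aY] := AG Y AY; have [i _ Ua] := GU a Ga.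
  exists i => k; rewrite -aY; apply: le_lt_trans (ler_line_proj _ _ _ _ (w01 k)) _.
  rewrite /rho ltr_pwDr// ler_pM2l//; apply: dmP => //.
  by apply: ptP; exists a.
have mP' : K^-1 <= \sum_(i < m) (3 * rho i) ^+ e by rewrite -ler_pdivrMl// mulr1 in mP.
(* The constant 12 = 2 * 6 comes from [exprD_le2]. The other summand is a power of a number at most
   1, and as [e > 0] it is bounded by that number, which is summable in [i]. *)
have term i : (3 * rho i) ^+ e <= 12 ^+ e * dm i ^+ e + tau / (2 ^ i.+1)%:R.
  have -> : 3 * rho i = 6 * dm i + 3 * eta i by rewrite /rho; ring.
  have a0 : 0 <= 6 * dm i by rewrite mulr_ge0.
  have b0 : 0 <= 3 * eta i by rewrite mulr_ge0// ltW.
  apply: le_trans (exprD_le2 e a0 b0) _.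
  rewrite mulrDr -!exprMn mulrA mulrA -!natrM lerD2l.
  have -> : (2 * 3)%N%:R * eta i = tau / (2 ^ i.+1)%:R by rewrite /eta; field; rewrite gt_eqF.
  rewrite -[leRHS]expr1; apply: ler_wiXn2l => //.
    by rewrite divr_ge0// ltW.
  by rewrite ler_pdivrMr// mul1r (le_trans tau1)// ler1n expn_gt0.
have half : \sum_(i < m) tau / (2 ^ i.+1)%:R <= tau.
  rewrite -lee_fin -sumEFin; apply: le_trans (epsilon_trick0 xpredT (ltW tau0)).
  rewrite -(big_mkord xpredT (fun i => (tau / (2 ^ i.+1)%:R)%:E)).
  by apply: nneseries_lim_ge => i _ _; rewrite lee_fin divr_ge0// ltW.
have fin : (K^-1 - tau) / 12 ^+ e <= \sum_(i < m) dm i ^+ e.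
  rewrite ler_pdivrMr ?exprn_gt0// lerBlDr (le_trans mP')//.
  rewrite mulrC mulr_sumr; apply: le_trans (lerD (lexx _) half).
  by rewrite -big_split/=; apply: ler_sum => i _; exact: term.
apply: (@le_trans _ _ (\sum_(i < m) dm i ^+ e)%:E); first by rewrite lee_fin.
rewrite -sumEFin -(big_mkord xpredT (fun i => (dm i ^+ e)%:E)).
apply: le_trans (nneseries_lim_ge m _); last first.
  by move=> i _ _; apply: expe_ge0; exact: ediam_ge0.
by apply: lee_sum => i _; rewrite dmE EFin_expe.
Qed.

(** * Translates of the direction and the final estimate *)

(** Moves the parameter of the line from its trace [q] on the hyperplane [x_0 = 0] to the foot [a]
    on the orthogonal complement: [q] minus its component along [dirv w]. *)
Lemma perp_translate_graph_line (R : realType) e (w y : 'I_e -> R) :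
  exists a, [/\ perp <[dirv w]>%VS a, graph_line w y a &
    translate <[dirv w]>%VS a = graph_line w y].
Proof.
pose q : 'rV[R]_e.+1 := \row_i (if unlift ord0 i is Some k then y k else 0).
set v := dirv w; have v0 : 0 < dotv v v.
  by rewrite -sqr_enorm exprn_gt0// (lt_le_trans ltr01)// enorm_dirv_ge1.
pose c := dotv v q / dotv v v.
have [a [pa aL]] : exists a, perp <[v]>%VS a /\ graph_line w y a.
  exists (q + (- c) *: v); split; last by move=> k; rewrite !mxE unlift_none liftK; ring.
  move=> _ /vlineP[s ->]; rewrite dotvZl dotvDr dotvZr /c mulNr divfK ?gt_eqF//.
  by rewrite subrr mulr0.
exists a; split => //.
apply/seteqP; split => [_ [_ /= /vlineP[s ->] <-] k|z zL].
  rewrite (mxE _ _ 0 (lift ord0 k)) (mxE _ _ 0 0) (aL k).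
  by rewrite (mxE _ _ 0 (lift ord0 k)) (mxE _ _ 0 0) dirvS dirv0; ring.
exists (z - a); last by rewrite subrK.
apply/vlineP; exists (z 0 0 - a 0 0); apply/rowP => i.
rewrite (mxE _ _ 0 i) (mxE _ _ 0 i) [RHS](mxE _ _ 0 i).
case: (unliftP ord0 i) => [k ->|->]; last first.
  by rewrite (_ : ord0 = 0) ?dirv0 ?mulr1//; exact: val_inj.
by rewrite dirvS (zL k) (aL k); ring.
Qed.

(* The line has to depend on E: for a fixed l, the product of a segment of l
   with a Lebesgue null compact subset of its orthogonal complement of
   dimension > d - 2 has positive F-capacity but null projection along l. *)
Theorem lemma5p8 (R : realType) (d : nat) (hd : (2 <= d)%N) :
  exists c k : R, [/\ 0 < c, 0 < k &
    forall alpha beta : R, 0 < alpha -> 0 < beta ->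
    forall F h : R -> R,
      gauge_extension (F_gauge d alpha beta) F ->
      gauge_extension (h_gauge alpha beta) h ->
    forall (x0 : 'rV[R]_d) (r : R), 0 < r <= 2^-1 * expR (- 3) ->
    forall E : set 'rV[R]_d, compact E -> E `<=` eball x0 r ->
    exists l : {vspace 'rV[R]_d}, \dim l = 1%N /\
      (c%:E * capacity F E * ((h (2 * r))^-1)%:E <=
       hausdorff d.-1
         [set a | perp l a /\
           (k * r ^- d.-1)%:E * capacity F E <=
             capacity h (E `&` translate l a)])%E].
Proof.
case: d hd => [//|e] e0; rewrite ltnS in e0.
have d0 : 0 < e.+1%:R :> R by [].
(* Here 8 = 4 * 2, with the 2 lost by the half-optimal measure and the 4 by the selection of good
   classes; 72 = 6 * 12 joins the count of directions with the passage from covering sets to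
   cubes. *)
exists (8 * (72 * e.+1%:R) ^+ e)^-1, (8 * (30 * e.+1%:R) ^+ e)^-1; split.
- by rewrite invr_gt0 mulr_gt0// exprn_gt0// mulr_gt0.
- by rewrite invr_gt0 mulr_gt0// exprn_gt0// mulr_gt0.
move=> alpha beta alpha0 beta0 F h [FE F0 Fm _] hext x0 r /andP[r0 r3] E cE Er.
have gh := gauge_of_extension alpha0 beta0 hext; have [hE _ _ _] := hext.
have dim1 w : \dim <[dirv w : 'rV[R]_e.+1]>%VS = 1%N.
  rewrite dim_vline; case: eqVneq => // w0.
  by have := dirv0 w; rewrite w0 mxE => /eqP; rewrite eq_sym oner_eq0.
have h2r : 0 < h (2 * r) by rewrite (gauge_gt0 gh)// mulr_gt0.
(* At zero capacity, in particular for empty [E], any direction serves. *)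
have [C0|C0] := leP (capacity F E) 0%E.
  exists <[dirv (fun=> 0%R : R)]>%VS; split; first exact: dim1.
  apply: le_trans (hausdorff_ge0 _ _).
  rewrite mule_le0_ge0 ?lee_fin ?invr_ge0 ?(ltW h2r)//.
  by rewrite mule_ge0_le0// lee_fin invr_ge0 mulr_ge0// exprn_ge0// mulr_ge0.
have [mu [J [rmu smu mu1 en [J0 CJ]]]] := half_optimal_measure F0 Fm cE Er r0 C0.
have r2 : 2 * r <= expR (- 3) by rewrite mulrC -ler_pdivlMr// mulrC.
have r1 : 2 * r <= 1 by apply: le_trans r2 _; rewrite -expR0 ler_expR oppr_le0.
have Fh t : 0 < t -> t <= 2 * r -> F t = t ^+ e * h t.
  move=> t0 t2; have t3 : 0 < t <= expR (- 3) by rewrite t0 (le_trans t2).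
  by rewrite FE// hE// /F_gauge /h_gauge mulrA.
have [wl [A [w01 Acap Acov]]] :=
  limit_family gh F0 Fm Fh r0 r1 J0 cE Er rmu smu mu1 en.
exists <[dirv wl]>%VS; split; first exact: dim1.
have [Cap CapE] : exists Cap, capacity F E = Cap%:E.
  by exists (fine (capacity F E)); rewrite fineK// ge0_fin_numE ?(ltW C0)// (le_lt_trans CJ)// ltry.

rewrite CapE lte_fin in C0; rewrite CapE lee_fin in CJ.
pose K := 4 * h (2 * r) * ((6 * e.+1%:R) ^+ e * J).
have K0 : 0 < K by rewrite !mulr_gt0// exprn_gt0// mulr_gt0.
apply: le_trans (hausdorff_ge_of_cubes (x0 := x0) (r := r) e0 K0 w01 _ Acov).
- rewrite CapE -!EFinM lee_fin /K.
  have -> : (8 * (72 * e.+1%:R) ^+ e)^-1 * Cap / h (2 * r) =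
     Cap / (8 * (72 * e.+1%:R) ^+ e * h (2 * r)).
    by rewrite [in RHS]invfM; ring.
  have -> : 4 * h (2 * r) * ((6 * e.+1%:R) ^+ e * J) * 12 ^+ e =
     (8 * (72 * e.+1%:R) ^+ e * h (2 * r)) * (J / 2).
    have -> : (72 * e.+1%:R) ^+ e = (6 * e.+1%:R) ^+ e * 12 ^+ e :> R.
      by rewrite -exprMn; congr (_ ^+ _); ring.
    by field.
  rewrite [leRHS]invfM mulrC ler_pM2l ?invr_gt0 ?mulr_gt0 ?exprn_gt0 ?mulr_gt0//.
  by rewrite invf_div.
- move=> Y AY.
  pose y k := Y k + x0 0 (lift ord0 k) - wl k * x0 0 0 - 2 * r.
  have [a [pa aL tL]] := perp_translate_graph_line wl y.
  exists a; last by move=> k; rewrite /line_proj !(mxE _ _ 0 _) (aL k) /y; lra.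
  split => //; rewrite tL.
  have LE : [set z | forall k, line_proj x0 r wl z k = Y k] = graph_line wl y.
    by apply/seteqP; split => z zP k; have := zP k; rewrite /line_proj /y !mxE; lra.
  have := Acap Y AY; rewrite LE; apply: le_trans.
  rewrite CapE -EFinM lee_fin (exprMn e (30 * e.+1%:R)) /=.
  have -> : (8 * (30 * e.+1%:R) ^+ e)^-1 / r ^+ e * Cap = 
     (4 * ((30 * e.+1%:R) ^+ e * r ^+ e))^-1 * (Cap / 2).
    by rewrite !invfM; field; rewrite !gt_eqF ?exprn_gt0 ?mulr_gt0.
  rewrite [leRHS]invfM ler_pM2l ?invr_gt0 ?mulr_gt0 ?exprn_gt0 ?mulr_gt0//.
  by rewrite ler_pdivrMr// mulrC.
Qed.
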